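(* Let $\kappa$ be an algebraically closed field of characteristic zero, complete for a non-trivial non-Archimedean absolute value. Let $n$ be a positive integer and let $\Omega(X_0,\dots,X_n)=\sum_{i\in I}c_iX_0^{i_0}\cdots X_n^{i_n}$ be a non-zero polynomial with coefficients $c_i\in\mathcal{M}(\kappa)$. Let $f\in\mathcal{M}(\kappa)$ be non-constant with $$\Omega(f,f',\dots,f^{(n)})=0$$ and admissible, i.e. $\sum_{i\in I}T(r,c_i)=o(T(r,f))$ as $r\to\infty$. If $a\in\mathcal{M}(\kappa)$ satisfies $T(r,a)=o(T(r,f))$ and $\Omega(a,a',\dots,a^{(n)})\not\equiv0$, then $$m\!\left(r,\frac1{f-a}\right)=o(T(r,f))\quad(r\to\infty).$$
   Context: $\mathcal{M}(\kappa)$ is the field of meromorphic functions over $\kappa$ (quotients of power series converging on all of $\kappa$). For entire $g=\sum a_nz^n$, $\mu(r,g)=\max_n|a_n|r^n$, and for $f=g/h$, $\mu(r,f)=\mu(r,g)/\mu(r,h)$; $m(r,f)=\log^+\mu(r,f)$; $N(r,f)=\int_0^r\frac{n(t,f)-n(0,f)}{t}dt+n(0,f)\log r$ where $n(t,f)$ counts poles in $|z|\le t$ with multiplicity; $T(r,f)=m(r,f)+N(r,f)$. *)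

(* Defs.v *)
From HB Require Import structures.
From mathcomp Require Import all_boot all_order all_algebra.
From mathcomp Require Import all_classical all_reals all_analysis.
Set Implicit Arguments. Unset Strict Implicit. Unset Printing Implicit Defensive.
Import Order.TTheory GRing.Theory Num.Theory.
Import numFieldNormedType.Exports.
Local Open Scope classical_set_scope.
Local Open Scope ring_scope.

Section NonArchNevanlinna.
Variables (R : realType) (K : fieldType) (abs : K -> R).

Definition nonarch_abs : Prop :=
  [/\ forall x, 0 <= abs x,
      forall x, abs x = 0 <-> x = 0,
      forall x y, abs (x * y) = abs x * abs y &
      forall x y, abs (x + y) <= Num.max (abs x) (abs y)].

Definition nontrivial_abs : Prop := exists x : K, abs x != 0 /\ abs x != 1.

Definition abs_cauchy (u : nat -> K) : Prop :=
  forall e : R, 0 < e -> exists N, forall m k, (N <= m)%N -> (N <= k)%N ->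
    abs (u m - u k) < e.

Definition abs_cvg_to (u : nat -> K) (l : K) : Prop :=
  forall e : R, 0 < e -> exists N, forall m, (N <= m)%N -> abs (u m - l) < e.

Definition complete_abs : Prop :=
  forall u : nat -> K, abs_cauchy u -> exists l, abs_cvg_to u l.

Definition series_to (u : nat -> K) (l : K) : Prop :=
  abs_cvg_to (fun m => \sum_(i < m) u i) l.

Definition entire (a : nat -> K) : Prop :=
  forall z : K, exists l, series_to (fun k => a k * z ^+ k) l.

Definition ps_mul (a b : nat -> K) : nat -> K :=
  fun k => \sum_(i < k.+1) a i * b (k - i)%N.
Definition ps_add (a b : nat -> K) : nat -> K := fun k => a k + b k.
Definition ps_opp (a : nat -> K) : nat -> K := fun k => - a k.
Definition ps_der (a : nat -> K) : nat -> K := fun k => a k.+1 * k.+1%:R.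
Definition ps_const (c : K) : nat -> K := fun k => if k == 0%N then c else 0.

(** ---- meromorphic functions: quotients g/h of entire functions ---- *)
Definition mero := ((nat -> K) * (nat -> K))%type.

Definition is_mero (f : mero) : Prop :=
  [/\ entire f.1, entire f.2 & exists k, f.2 k != 0].

Definition mero_eq (f g : mero) : Prop :=
  ps_mul f.1 g.2 = ps_mul g.1 f.2.

Definition mero_const (c : K) : mero := (ps_const c, ps_const 1).
Definition mero0 : mero := mero_const 0.
Definition mero1 : mero := mero_const 1.
Definition mero_add (f g : mero) : mero :=
  (ps_add (ps_mul f.1 g.2) (ps_mul g.1 f.2), ps_mul f.2 g.2).
Definition mero_opp (f : mero) : mero := (ps_opp f.1, f.2).
Definition mero_sub (f g : mero) : mero := mero_add f (mero_opp g).
Definition mero_mul (f g : mero) : mero := (ps_mul f.1 g.1, ps_mul f.2 g.2).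
Definition mero_inv (f : mero) : mero := (f.2, f.1).
Definition mero_der (f : mero) : mero :=
  (ps_add (ps_mul (ps_der f.1) f.2) (ps_opp (ps_mul f.1 (ps_der f.2))),
   ps_mul f.2 f.2).
Definition mero_exp (f : mero) (k : nat) : mero := iter k (mero_mul f) mero1.

Definition nonconstant (f : mero) : Prop := forall c : K, ~ mero_eq f (mero_const c).

(** ---- polynomials Omega(X_0,...,X_n) with coefficients in M(K) ----
    Omega = sum_(i in I) c_i X_0^(i 0) ... X_n^(i n), I a duplicate-free list
    of multi-indices. *)
Definition mero_diff_poly_eval (n : nat) (I : seq {ffun 'I_n.+1 -> nat})
    (c : {ffun 'I_n.+1 -> nat} -> mero) (f : mero) : mero :=
  foldr (fun i acc => mero_add
           (mero_mul (c i)
              (foldr (fun k p => mero_mul (mero_exp (iter (nat_of_ord k) mero_der f) (i k)) p)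
                     mero1 (enum 'I_n.+1)))
           acc) mero0 I.

Definition mu_ps (r : R) (a : nat -> K) : R := sup (range (fun k => abs (a k) * r ^+ k)).
Definition mu_mero (r : R) (f : mero) : R := mu_ps r f.1 / mu_ps r f.2.
Definition logp (x : R) : R := Num.max 0 (ln x).
Definition m_prox (r : R) (f : mero) : R := logp (mu_mero r f).

Definition taylor_coef (a : nat -> K) (z : K) (k : nat) : K :=
  xget 0 [set v | series_to (fun j => 'C(j + k, k)%:R * a (j + k)%N * z ^+ j) v].

Definition zord (a : nat -> K) (z : K) : nat :=
  xget 0%N [set m | (forall k, (k < m)%N -> taylor_coef a z k = 0) /\
                    taylor_coef a z m != 0].

Definition pole_mult (f : mero) (z : K) : nat := (zord f.2 z - zord f.1 z)%N.

Definition n_poles (t : R) (f : mero) : R :=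
  sup [set x | exists s : seq K, [/\ uniq s, all (fun z => abs z <= t) s &
                 x = (\sum_(z <- s) pole_mult f z)%:R]].

Definition N_count (r : R) (f : mero) : R :=
  Rintegral (@lebesgue_measure R) `[0, r]
     (fun t => (n_poles t f - n_poles 0 f) / t)
  + n_poles 0 f * ln r.

Definition T_char (r : R) (f : mero) : R := m_prox r f + N_count r f.

Definition little_o_pinfty (u v : R -> R) : Prop :=
  forall eps : R, 0 < eps -> exists r0 : R, forall r, r0 < r -> `|u r| <= eps * `|v r|.

End NonArchNevanlinna.

(* Main.v *)
Require Import Defs.
From HB Require Import structures.
From mathcomp Require Import all_boot all_order all_algebra.
From mathcomp Require Import all_classical all_reals all_analysis.
From mathcomp Require Import measurable_realfun ring lra zify.
Set Implicit Arguments. Unset Strict Implicit. Unset Printing Implicit Defensive.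
Import Order.TTheory GRing.Theory Num.Theory.
Import numFieldNormedType.Exports.
Local Open Scope classical_set_scope.
Local Open Scope ring_scope.

(** Write [f = a + g].  Expanding the equation, [Omega(f) - Omega(a)] is a sum of
    terms each containing a factor [g^(k)]; since [mu(r, h') <= mu(r, h) / r], for
    [r >= 1] and [mu(r, g) <= 1] this gives
    [mu(r, Omega(a)) <= prod_i max(1, mu(r, c_i)) max(1, mu(r, a))^d mu(r, g)].
    Hence [m(r, 1/g)] is at most [- ln mu(r, Omega(a))] up to proximity functions
    of the [c_i] and of [a].  By the Poisson-Jensen formula,
    [- ln mu(r, Omega(a))] is bounded by the counting function of the poles of
    [Omega(a)], and these are controlled point by point by the poles of the [c_i]
    and of [a].  The additive constants are absorbed because [T(r, f)] tends to
    infinity.  The Poisson-Jensen formula comes from factoring an entire function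
    on a disc as a product of linear factors [X - z] and a zero-free function,
    whose maximum modulus is its constant term: zeros are produced as limits of
    roots of the Taylor truncations, and their number is the central index, which
    is additive under products. *)

(** * The ring of formal power series *)

(** Three choices shape the argument. A meromorphic function is an unreduced pair of series, and
    [zord] of the zero series falls back to 0, so [pole_mult] does not behave well under the
    operations on pairs. Upper bounds for poles are therefore expressed by powers of [X - z]
    dividing numerator and denominator, common factors allowed. These bounds are deliberately crude
    and linear: orders add under sums as well as under products, and double under derivation. A
    pole-free point stays pole-free, and the loss only enlarges the constant in front of [T(r, a)],
    which the smallness of [a] absorbs. Finally, the expansion of the equation is replaced by a
    comparison: being close relative to [mu(r, f - a)] passes through every operation without
    numerical loss, because the ultrametric inequality replaces sums by maxima and integers have
    absolute value at most 1. Hence the estimates hold at every radius [r >= 1], with no exceptional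
    set. *)

(* A fresh name is needed because [nat -> K] carries the pointwise ring structure. *)
Definition psr (K : fieldType) := nat -> K.

Section PowerSeriesRing.
Variable K : fieldType.
Implicit Types a b c : nat -> K.

Definition ps_trunc n a : {poly K} := \poly_(i < n) a i.

(** A coefficient of a Cauchy product sees only finitely many coefficients of the factors. This
    transfers associativity, commutativity and the Leibniz rule from [{poly K}] to power series. *)
Lemma coef_ps_mul a b n k : (k < n)%N ->
  ps_mul a b k = (ps_trunc n a * ps_trunc n b)`_k.
Proof.
move=> kn; rewrite coefM; apply: eq_bigr => i _.
by rewrite !coef_poly (leq_ltn_trans (leq_ord i) kn) (leq_ltn_trans (leq_subr _ _) kn).
Qed.

Lemma ps_trunc_mul a b n k : (k < n)%N ->
  (ps_trunc n (ps_mul a b))`_k = (ps_trunc n a * ps_trunc n b)`_k.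
Proof. by move=> kn; rewrite coef_poly kn; exact: coef_ps_mul. Qed.

Lemma ps_mulA : associative (@ps_mul K).
Proof.
move=> a b c; apply/funext => k; have kk := ltnSn k.
rewrite (coef_ps_mul _ _ kk) (coef_ps_mul _ _ kk) coefM.
transitivity ((ps_trunc k.+1 a * (ps_trunc k.+1 b * ps_trunc k.+1 c))`_k).
  rewrite [RHS]coefM; apply: eq_bigr => i _; congr (_ * _).
  by rewrite ps_trunc_mul // ltnS leq_subr.
rewrite mulrA [LHS]coefM [RHS]coefM; apply: eq_bigr => i _; congr (_ * _).
by rewrite ps_trunc_mul.
Qed.

Lemma ps_mulC : commutative (@ps_mul K).
Proof.
move=> a b; apply/funext => k.
by rewrite (coef_ps_mul _ _ (ltnSn k)) mulrC -coef_ps_mul.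
Qed.

Lemma ps_mul1 : left_id (ps_const 1) (@ps_mul K).
Proof.
move=> a; apply/funext => k; rewrite /ps_mul big_ord_recl subn0 mul1r.
by rewrite big1 ?addr0 // => i _; rewrite mul0r.
Qed.

Lemma ps_mulDl : left_distributive (@ps_mul K) (@ps_add K).
Proof.
move=> a b c; apply/funext => k; rewrite /ps_mul /ps_add -big_split /=.
by apply: eq_bigr => i _; rewrite mulrDl.
Qed.

Lemma ps_addA : associative (@ps_add K).
Proof. by move=> a b c; apply/funext => k; exact: addrA. Qed.
Lemma ps_addC : commutative (@ps_add K).
Proof. by move=> a b; apply/funext => k; exact: addrC. Qed.
Lemma ps_add0 : left_id (ps_const 0) (@ps_add K).
Proof. by move=> a; apply/funext => k; rewrite /ps_add /ps_const if_same add0r. Qed.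
Lemma ps_addN : left_inverse (ps_const 0) (@ps_opp K) (@ps_add K).
Proof. by move=> a; apply/funext => k; rewrite /ps_add /ps_opp addNr /ps_const if_same. Qed.

Lemma ps_1_neq0 : ps_const 1 != ps_const 0 :> psr K.
Proof. by apply/eqP => /(congr1 (fun g => g 0%N)) /eqP; rewrite oner_eq0. Qed.

HB.instance Definition _ := Choice.copy (psr K) (nat -> K).
HB.instance Definition _ := GRing.isZmodule.Build (psr K) ps_addA ps_addC ps_add0 ps_addN.
HB.instance Definition _ := GRing.Zmodule_isComNzRing.Build (psr K)
  ps_mulA ps_mulC ps_mul1 ps_mulDl ps_1_neq0.

Implicit Types P Q : psr K.

Lemma ps_addE P Q k : (P + Q) k = P k + Q k. Proof. by []. Qed.
Lemma ps_oppE P k : (- P) k = - P k. Proof. by []. Qed.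
Lemma ps_mulE P Q k : (P * Q) k = \sum_(i < k.+1) P i * Q (k - i)%N. Proof. by []. Qed.
Lemma ps_zeroE k : (0 : psr K) k = 0. Proof. by rewrite /GRing.zero /= /ps_const if_same. Qed.

Lemma ps_const0 : ps_const 0 = 0 :> psr K. Proof. by []. Qed.

Lemma ps_neq0P P : reflect (exists k, P k != 0) (P != 0).
Proof.
apply: (iffP idP) => [P0|[k Pk]]; last by apply: contra_neq Pk => ->; exact: ps_zeroE.
apply: contrapT => H; case/eqP: P0; apply/funext => k; rewrite ps_zeroE.
by apply/eqP; apply: contra_notT H => Pk; exists k.
Qed.

Lemma ps_derM P Q : ps_der (P * Q) = (ps_der P : psr K) * Q + P * (ps_der Q : psr K).
Proof.
apply/funext => k; pose p := ps_trunc k.+2 P; pose q := ps_trunc k.+2 Q.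
have e1 : (P * Q) k.+1 = (p * q)`_k.+1 by exact: coef_ps_mul.
have e2 (S : psr K) j : (j < k.+1)%N -> ps_der S j = (ps_trunc k.+2 S)^`()`_j.
  by move=> jk; rewrite coef_deriv coef_poly ltnS jk /ps_der mulr_natr.
rewrite /ps_der e1 mulr_natr -coef_deriv derivM coefD ps_addE !ps_mulE !coefM.
congr (_ + _); apply: eq_bigr => i _.
  by rewrite -e2 // coef_poly ltnS (leq_trans (leq_subr _ _)).
rewrite -e2 ?ltnS ?leq_subr // coef_poly ltnS (leq_trans (leq_ord i)) //.
Qed.

Lemma ps_derD P Q : ps_der (P + Q) = (ps_der P : psr K) + (ps_der Q : psr K).
Proof. by apply/funext => k; rewrite ps_addE /ps_der ps_addE mulrDl. Qed.

Lemma ps_derN P : ps_der (- P) = - (ps_der P : psr K).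
Proof. by apply/funext => k; rewrite ps_oppE /ps_der ps_oppE mulNr. Qed.

Definition XsubC (z : K) : psr K := fun k => if k == 0%N then - z else if k == 1%N then 1 else 0.

Lemma ps_der_XsubC z : ps_der (XsubC z) = 1 :> psr K.
Proof. by apply/funext => -[|k] /=; rewrite /ps_der /XsubC /= ?mul1r ?mul0r. Qed.

Lemma XsubC_mul0 z P : (XsubC z * P) 0%N = - z * P 0%N.
Proof. by rewrite ps_mulE big_ord1. Qed.

Lemma XsubC_mulS z P k : (XsubC z * P) k.+1 = P k - z * P k.+1.
Proof.
rewrite ps_mulE 2!big_ord_recl big1 ?addr0 => [|i _]; last by rewrite mul0r.
by rewrite /= /bump /= subn1 mul1r mulNr addrC subn0.
Qed.

End PowerSeriesRing.
Arguments XsubC {K} z.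

(** * Non-Archimedean absolute values *)

Section AbsoluteValue.
Variables (R : realType) (K : fieldType) (abs : K -> R).
Hypothesis Habs : nonarch_abs abs.
Implicit Types (r e : R) (x y z : K).

Lemma abs_ge0 x : 0 <= abs x. Proof. by have [] := Habs. Qed.
Lemma absM x y : abs (x * y) = abs x * abs y. Proof. by have [] := Habs. Qed.
Lemma abs_eq0 x : (abs x == 0) = (x == 0).
Proof. by have [_ H _ _] := Habs; apply/eqP/eqP => /H. Qed.
Lemma abs0 : abs 0 = 0. Proof. by apply/eqP; rewrite abs_eq0. Qed.
Lemma abs_gt0 x : (0 < abs x) = (x != 0).
Proof. by rewrite lt_def abs_ge0 andbT abs_eq0. Qed.
Lemma abs1 : abs 1 = 1.
Proof.
have n0 : abs 1 != 0 by rewrite abs_eq0 oner_eq0.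
by apply: (mulfI n0); rewrite -absM !mulr1.
Qed.
Lemma absN x : abs (- x) = abs x.
Proof.
suff -> : abs (- x) = abs (-1) * abs x.
  suff -> : abs (-1) = 1 by rewrite mul1r.
  apply/eqP; rewrite -(eqrXn2 (n := 2)) ?abs_ge0 ?ler01 //.
  by rewrite expr1n expr2 -absM mulrNN mulr1 abs1.
by rewrite -absM mulN1r.
Qed.
Lemma absX x k : abs (x ^+ k) = abs x ^+ k.
Proof. by elim: k => [|k IH]; rewrite ?abs1 // !exprS absM IH. Qed.
Lemma abs_add_max x y : abs (x + y) <= Num.max (abs x) (abs y).
Proof. by have [] := Habs. Qed.
Lemma abs_sub_max x y : abs (x - y) <= Num.max (abs x) (abs y).
Proof. by rewrite -(absN y); exact: abs_add_max. Qed.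
Lemma absB x y : abs (x - y) = abs (y - x).
Proof. by rewrite -absN opprB. Qed.
Lemma abs_add_le x y e : abs x <= e -> abs y <= e -> abs (x + y) <= e.
Proof. by move=> xe ye; apply: le_trans (abs_add_max _ _) _; rewrite ge_max xe. Qed.
Lemma abs_add_lt x y e : abs x < e -> abs y < e -> abs (x + y) < e.
Proof. by move=> xe ye; apply: le_lt_trans (abs_add_max _ _) _; rewrite gt_max xe. Qed.
Lemma abs_add_eq x y : abs x < abs y -> abs (x + y) = abs y.
Proof.
move=> xy; apply/eqP; rewrite eq_le abs_add_le //=; last exact: ltW.
have := abs_sub_max (x + y) x; rewrite addrC addKr le_max => /orP[//|].
by rewrite leNgt xy.
Qed.

Lemma abs_sum_le (J : Type) (s : seq J) (P : pred J) (F : J -> K) e : 0 <= e ->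
  (forall j, P j -> abs (F j) <= e) -> abs (\sum_(j <- s | P j) F j) <= e.
Proof.
move=> e0 H; apply: (big_ind (fun x => abs x <= e)) => //; first by rewrite abs0.
by move=> x y; exact: abs_add_le.
Qed.
Lemma abs_sum_lt (J : Type) (s : seq J) (P : pred J) (F : J -> K) e : 0 < e ->
  (forall j, P j -> abs (F j) < e) -> abs (\sum_(j <- s | P j) F j) < e.
Proof.
move=> e0 H; apply: (big_ind (fun x => abs x < e)) => //; first by rewrite abs0.
by move=> x y; exact: abs_add_lt.
Qed.
Lemma abs_nat k : abs k%:R <= 1.
Proof.
elim: k => [|k IH]; first by rewrite abs0 ler01.
by rewrite -natr1; apply: abs_add_le => //; rewrite abs1.
Qed.

(** Entireness rephrased with real radii, since an arbitrary [r] need not be the absolute value of a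
    point of [K]; [entireP] gives the equivalence. *)
Definition tame (a : nat -> K) : Prop := forall r e, 0 < r -> 0 < e ->
  exists N, forall k, (N <= k)%N -> abs (a k) * r ^+ k < e.

Lemma abs_cvg_unique (u : nat -> K) l l' :
  abs_cvg_to abs u l -> abs_cvg_to abs u l' -> l = l'.
Proof.
move=> ul ul'; apply/eqP; rewrite -subr_eq0; apply: contraT => ll'.
have e0 : 0 < abs (l - l') by rewrite abs_gt0.
have [N HN] := ul _ e0; have [N' HN'] := ul' _ e0.
suff : abs (l - l') < abs (l - l') by rewrite ltxx.
have E : l - l' = (l - u (maxn N N')) + (u (maxn N N') - l') by ring.
rewrite {1}E.
by apply: abs_add_lt; [rewrite (absB l (u _)); apply: HN | apply: HN']; lia.
Qed.

Lemma abs_cvg_le (u : nat -> K) l e N : 0 < e -> abs_cvg_to abs u l ->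
  (forall k, (N <= k)%N -> abs (u k) <= e) -> abs l <= e.
Proof.
move=> e0 ul H; have [N' HN'] := ul _ e0.
have E : l = u (maxn N N') - (u (maxn N N') - l) by ring.
rewrite {1}E; apply: le_trans (abs_sub_max _ _) _.
by rewrite ge_max H ?leq_maxl //= ltW // HN' // leq_maxr.
Qed.

Lemma abs_cvg_sub_null (u v : nat -> K) l :
  abs_cvg_to abs u l -> abs_cvg_to abs (fun k => v k - u k) 0 -> abs_cvg_to abs v l.
Proof.
move=> ul vu e e0; have [N HN] := ul _ e0; have [N' HN'] := vu _ e0.
exists (maxn N N') => k; rewrite geq_max => /andP[Nk Nk'].
have -> : v k - l = (v k - u k - 0) + (u k - l) by ring.
by apply: abs_add_lt; [exact: HN' | exact: HN].
Qed.

Lemma series_null (u : nat -> K) l : series_to abs u l -> abs_cvg_to abs u 0.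
Proof.
move=> ul e e0; have [N HN] := ul _ e0; exists N => k Nk; rewrite subr0.
have -> : u k = (\sum_(i < k.+1) u i - l) - (\sum_(i < k) u i - l).
  by rewrite big_ord_recr /=; ring.
apply: le_lt_trans (abs_sub_max _ _) _.
by rewrite gt_max !HN // ltnW.
Qed.

(** By the ultrametric inequality a telescoping sum is no larger than its largest term, so
    consecutive differences suffice. *)
Lemma abs_cauchy_succ (u : nat -> K) :
  (forall e, 0 < e -> exists N, forall k, (N <= k)%N -> abs (u k.+1 - u k) < e) ->
  abs_cauchy abs u.
Proof.
move=> H e e0; have [N HN] := H e e0; exists N.
suff H' m k : (N <= m)%N -> (m <= k)%N -> abs (u k - u m) < e.
  by move=> m k Nm Nk; case: (leqP m k) => [|/ltnW] mk; [rewrite absB|]; apply: H'.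
move=> Nm; elim: k => [|k IH]; first by rewrite leqn0 => /eqP ->; rewrite subrr abs0.
rewrite leq_eqVlt => /orP[/eqP ->|]; first by rewrite subrr abs0.
rewrite ltnS => mk; have -> : u k.+1 - u m = (u k.+1 - u k) + (u k - u m) by ring.
by apply: abs_add_lt; [apply: HN; apply: leq_trans mk | exact: IH].
Qed.

Hypothesis Hcompl : complete_abs abs.

Lemma series_cvg (u : nat -> K) : abs_cvg_to abs u 0 -> exists l, series_to abs u l.
Proof.
move=> u0; apply: Hcompl; apply: abs_cauchy_succ => e e0.
have [N HN] := u0 _ e0; exists N => k Nk.
by rewrite big_ord_recr /= addrAC subrr add0r -[u k]subr0 HN.
Qed.

Hypothesis Hnontriv : nontrivial_abs abs.

Lemma abs_unbounded r : exists z, r < abs z.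
Proof.
have [x [x0 x1]] := Hnontriv.
have [y y1] : exists y, 1 < abs y.
  have [lt1|] := ltP 1 (abs x); first by exists x.
  rewrite le_eqVlt (negbTE x1) /= => xl1; exists x^-1.
  have nx : x != 0 by rewrite -abs_eq0.
  have : abs x * abs x^-1 = 1 by rewrite -absM divff // abs1.
  have : 0 < abs x by rewrite abs_gt0.
  by nra.
(* Bernoulli's inequality: the powers of an element of absolute value above 1 are unbounded. *)
have b k : 1 + k%:R * (abs y - 1) <= abs y ^+ k.
  elim: k => [|k IH]; first by rewrite expr0 mul0r addr0.
  have k0 : 0 <= k%:R :> R by [].
  have y0 : 0 <= abs y by lra.
  have := ler_wpM2l y0 IH; rewrite exprS -natr1.
  have : 0 <= k%:R * (abs y - 1) ^+ 2 by rewrite mulr_ge0 // sqr_ge0.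
  lra.
have [k Hk] : exists k : nat, r < k%:R * (abs y - 1).
  have y0 : 0 < abs y - 1 by lra.
  exists (Num.bound (Num.max r 0 / (abs y - 1))); rewrite -ltr_pdivrMr //.
  apply: (@le_lt_trans _ _ (Num.max r 0 / (abs y - 1))).
    by apply: ler_wpM2r; rewrite ?invr_ge0 ?(ltW y0) // le_max lexx.
  by apply: archi_boundP; rewrite divr_ge0 ?(ltW y0) // le_max lexx orbT.
exists (y ^+ k); rewrite absX; have := b k; lra.
Qed.

Lemma entireP (a : nat -> K) : entire abs a <-> tame a.
Proof.
split=> [Ha r e r0 e0|Ha z].
  have [z rz] := abs_unbounded r; have [l /series_null /(_ e e0) [N HN]] := Ha z.
  exists N => k Nk; have := HN k Nk; rewrite subr0 absM absX; apply: le_lt_trans.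
  by apply: ler_wpM2l; first exact: abs_ge0 _; apply: lerXn2r; rewrite ?nnegrE ?abs_ge0 ?ltW.
apply: series_cvg => e e0.
(* [tame] speaks of positive radii and [abs z] may be 0, hence [abs z + 1]. *)
have z0 : 0 < abs z + 1 by have := abs_ge0 z; lra.
have [N HN] := Ha _ _ z0 e0; exists N => k Nk; rewrite subr0 absM absX.
apply: le_lt_trans (HN k Nk); apply: ler_wpM2l; first exact: abs_ge0.
by apply: lerXn2r; rewrite ?nnegrE ?abs_ge0 ?(ltW z0) // lerDl.
Qed.

End AbsoluteValue.

(** * Central index and maximum modulus *)

Section CentralIndex.
Variables (R : realType) (K : fieldType) (abs : K -> R).
Hypothesis Habs : nonarch_abs abs.
Implicit Types (r e : R) (x y z : K) (a b : psr K).
Local Notation w r a k := (abs (a k) * r ^+ k).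

(** The last index of a maximal term. Taking the last one makes it count the zeros in the closed
    disc: a root with [abs z = r] is included. *)
Definition central_index r a m : Prop :=
  (forall j, w r a j <= w r a m) /\ (forall j, (m < j)%N -> w r a j < w r a m).

Lemma weight_ge0 r a k : 0 < r -> 0 <= w r a k.
Proof. by move=> r0; rewrite mulr_ge0 ?(abs_ge0 Habs) ?exprn_ge0 ?ltW. Qed.

Lemma central_index_exists r a : 0 < r -> tame abs a -> a != 0 ->
  exists m, central_index r a m.
Proof.
move=> r0 ta /ps_neq0P [k0 ak0].
have e0 : 0 < w r a k0 by rewrite mulr_gt0 ?(abs_gt0 Habs) ?exprn_gt0.
have [N HN] := ta _ _ r0 e0.
have kN : (k0 < N)%N by rewrite ltnNge; apply/negP => /HN; rewrite ltxx.
pose P m := `[< forall j, w r a j <= w r a m >].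
have PN m : P m -> (m <= N)%N.
  move=> /asboolP /(_ k0) km; rewrite leqNgt; apply/negP => /ltnW /HN.
  by rewrite ltNge km.
have [i Pi] : exists i, P i.
  have [i _ Hi] := @Order.TotalTheory.arg_maxP _ _ _ (Ordinal kN) xpredT
                     (fun i : 'I_N => w r a i) isT.
  exists i; apply/asboolP => j; have [jN|Nj] := ltnP j N.
    exact: (Hi (Ordinal jN) isT).
  by apply: le_trans (Hi (Ordinal kN) isT); exact/ltW/HN.
have [m /asboolP Pm mmax] := ex_maxnP (ex_intro _ i Pi) PN.
exists m; split=> // j mj; rewrite lt_neqAle Pm andbT; apply/eqP => E.
suff /mmax : P j by rewrite leqNgt mj.
by apply/asboolP => l; rewrite E.
Qed.

Lemma central_index_gt0 r a m : 0 < r -> central_index r a m -> 0 < w r a m.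
Proof.
by move=> r0 [_ /(_ _ (ltnSn m))]; apply: le_lt_trans; exact: weight_ge0.
Qed.

Lemma weight_conv r a b i k : (i <= k)%N ->
  abs (a i * b (k - i)%N) * r ^+ k = w r a i * w r b (k - i)%N.
Proof. by move=> ik; rewrite (absM Habs) mulrACA -exprD subnKC. Qed.

Lemma weight_mul_le r a b A B k : 0 < r -> 0 <= A -> 0 <= B ->
  (forall j, w r a j <= A) -> (forall j, w r b j <= B) -> w r (a * b) k <= A * B.
Proof.
move=> r0 A0 B0 HA HB; have rk := exprn_gt0 k r0.
rewrite -ler_pdivlMr // ps_mulE; apply: (abs_sum_le Habs) => [|i _].
  by rewrite divr_ge0 ?mulr_ge0 // ltW.
by rewrite ler_pdivlMr // weight_conv ?leq_ord // ler_pM // weight_ge0.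
Qed.

(** Serves two cases: for [k = m + n] every [i] other than [m] satisfies one of the two
    alternatives, and for [k > m + n] every [i] does. *)
Lemma weight_mul_lt r a b m n i k : 0 < r ->
  central_index r a m -> central_index r b n -> (i <= k)%N ->
  (m < i)%N || (n < k - i)%N ->
  w r a i * w r b (k - i)%N < w r a m * w r b n.
Proof.
move=> r0 da db ik; have A0 := central_index_gt0 r0 da; have B0 := central_index_gt0 r0 db.
case: da db => [la sa] [lb sb] /orP[/sa|/sb] H.
  apply: (@le_lt_trans _ _ (w r a i * w r b n)); last by rewrite ltr_pM2r.
  by rewrite ler_wpM2l ?weight_ge0.
apply: (@le_lt_trans _ _ (w r a m * w r b (k - i)%N)); last by rewrite ltr_pM2l.
by rewrite ler_wpM2r ?weight_ge0.
Qed.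

(* Gauss's lemma: in the coefficient of index [m + n] the single product
   [a_m b_n] strictly dominates all the others. *)
Lemma central_index_mul_val r a b m n : 0 < r ->
  central_index r a m -> central_index r b n ->
  w r (a * b) (m + n)%N = w r a m * w r b n.
Proof.
move=> r0 da db; have rk := exprn_gt0 (m + n) r0.
have mm : (m < (m + n).+1)%N by rewrite ltnS leq_addr.
rewrite ps_mulE (bigD1 (Ordinal mm)) //= addrC (abs_add_eq Habs).
  by rewrite weight_conv ?leq_addr // addKn.
rewrite -(ltr_pM2r rk) weight_conv ?leq_addr // addKn -ltr_pdivlMr //.
apply: (abs_sum_lt Habs) => [|i im].
  apply: divr_gt0 => //; apply: mulr_gt0; first exact: central_index_gt0 da.
  exact: central_index_gt0 db.
rewrite ltr_pdivlMr // weight_conv ?leq_ord //.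
apply: weight_mul_lt => //; first exact: leq_ord.
have {im} : i != m :> nat by apply: contra im => /eqP im; apply/eqP/val_inj.
have := leq_ord i; lia.
Qed.

Lemma central_index_mul r a b m n : 0 < r ->
  central_index r a m -> central_index r b n -> central_index r (a * b) (m + n).
Proof.
move=> r0 da db; have A0 := central_index_gt0 r0 da; have B0 := central_index_gt0 r0 db.
rewrite /central_index (central_index_mul_val r0 da db); split=> j.
  by apply: weight_mul_le; rewrite ?ltW //; [case: da | case: db].
move=> mnj; have rk := exprn_gt0 j r0.
rewrite -ltr_pdivlMr // ps_mulE; apply: (abs_sum_lt Habs) => [|i _].
  by apply: divr_gt0 => //; apply: mulr_gt0.
rewrite ltr_pdivlMr // weight_conv ?leq_ord //.
apply: weight_mul_lt => //; first exact: leq_ord.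
by have := leq_ord i; lia.
Qed.

Lemma central_index_uniq r a m n : central_index r a m -> central_index r a n -> m = n.
Proof.
move=> [lm sm] [ln sn]; case: (ltngtP m n) => // mn.
  by have := le_lt_trans (ln m) (sm _ mn); rewrite ltxx.
by have := le_lt_trans (lm n) (sn _ mn); rewrite ltxx.
Qed.

Lemma central_index_neq0 r a m : 0 < r -> central_index r a m -> a != 0.
Proof.
move=> r0 /(central_index_gt0 r0) H; apply/ps_neq0P; exists m.
by apply: contraTneq H => ->; rewrite (abs0 Habs) mul0r ltxx.
Qed.

Lemma central_index_const r x : 0 < r -> x != 0 -> central_index r (ps_const x) 0.
Proof.
move=> r0 x0; rewrite /central_index /ps_const /= expr0 mulr1.
have x1 : 0 < abs x by rewrite (abs_gt0 Habs).
by split=> -[|j]//=; rewrite ?mulr1 ?(abs0 Habs) ?mul0r // ltW.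
Qed.

Lemma central_index_1 r : 0 < r -> central_index r 1 0.
Proof. by move=> r0; apply: central_index_const => //; rewrite oner_eq0. Qed.

(** The boolean is read as 0 or 1: a linear factor raises the central index exactly when its root
    lies in the closed disc. *)
Lemma central_index_XsubC r z : 0 < r -> central_index r (XsubC z) (abs z <= r)%R.
Proof.
move=> r0; rewrite /central_index /XsubC.
have [zr|rz] /= := leP (abs z) r.
  split=> -[|[|j]] //=; rewrite ?expr0 ?expr1 ?mulr1 ?(absN Habs) ?(abs1 Habs) ?mul1r //.
    by rewrite (abs0 Habs) mul0r ltW.
  by rewrite (abs0 Habs) mul0r.
have z0 := lt_trans r0 rz.
split=> -[|[|j]] //=; rewrite ?expr0 ?expr1 ?mulr1 ?(absN Habs) ?(abs1 Habs) ?mul1r //.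
- exact: ltW.
- by rewrite (abs0 Habs) mul0r ltW.
- by rewrite (abs0 Habs) mul0r.
Qed.

Lemma ps_mul_neq0 a b : tame abs a -> tame abs b -> a != 0 -> b != 0 -> a * b != 0.
Proof.
move=> ta tb a0 b0; have [m dm] := central_index_exists ltr01 ta a0.
have [n dn] := central_index_exists ltr01 tb b0.
exact: central_index_neq0 ltr01 (central_index_mul ltr01 dm dn).
Qed.

Lemma tame_bounded r a : 0 < r -> tame abs a -> exists2 M, 0 < M & forall k, w r a k <= M.
Proof.
move=> r0 ta; have [->|a0] := eqVneq a 0.
  by exists 1 => // k; rewrite ps_zeroE (abs0 Habs) mul0r ler01.
have [m dm] := central_index_exists r0 ta a0.
by exists (w r a m); [exact: central_index_gt0 | case: dm].
Qed.

Lemma tame_finite N a : (forall k, (N <= k)%N -> a k = 0) -> tame abs a.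
Proof. by move=> H r e r0 e0; exists N => k /H ->; rewrite (abs0 Habs) mul0r. Qed.

Lemma tame_const x : tame abs (ps_const x).
Proof. by apply: (@tame_finite 1) => -[]. Qed.
Lemma tame_1 : tame abs (1 : psr K). Proof. exact: tame_const. Qed.
Lemma tame_0 : tame abs (0 : psr K). Proof. exact: tame_const. Qed.
Lemma tame_XsubC z : tame abs (XsubC z).
Proof. by apply: (@tame_finite 2) => -[|[]]. Qed.

Lemma tame_add a b : tame abs a -> tame abs b -> tame abs (a + b).
Proof.
move=> ta tb r e r0 e0; have [N HN] := ta _ _ r0 e0; have [N' HN'] := tb _ _ r0 e0.
exists (maxn N N') => k; rewrite geq_max => /andP[/HN Nk /HN' Nk'].
by have rk := exprn_gt0 k r0; rewrite -ltr_pdivlMr //; apply: (abs_add_lt Habs); rewrite ltr_pdivlMr.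
Qed.

Lemma tame_opp a : tame abs a -> tame abs (- a).
Proof.
move=> ta r e r0 e0; have [N HN] := ta _ _ r0 e0.
by exists N => k /HN; rewrite ps_oppE (absN Habs).
Qed.

Lemma tame_sub a b : tame abs a -> tame abs b -> tame abs (a - b).
Proof. by move=> ta tb; apply: tame_add => //; apply: tame_opp. Qed.

Lemma tame_mul a b : tame abs a -> tame abs b -> tame abs (a * b).
Proof.
move=> ta tb r e r0 e0; have [Ma Ma0 HMa] := tame_bounded r0 ta.
have [Mb Mb0 HMb] := tame_bounded r0 tb.
have [N HN] := ta _ _ r0 (divr_gt0 e0 Mb0); have [N' HN'] := tb _ _ r0 (divr_gt0 e0 Ma0).
exists (N + N')%N => k Nk; have rk := exprn_gt0 k r0.
rewrite -ltr_pdivlMr // ps_mulE; apply: (abs_sum_lt Habs) => [|i _]; first by rewrite divr_gt0.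
rewrite ltr_pdivlMr // weight_conv ?leq_ord //.
have [Ni|iN] := leqP N i.
  apply: (@le_lt_trans _ _ (w r a i * Mb)); first by rewrite ler_wpM2l ?weight_ge0.
  by rewrite -ltr_pdivlMr // HN.
apply: (@le_lt_trans _ _ (Ma * w r b (k - i)%N)); first by rewrite ler_wpM2r ?weight_ge0.
by rewrite mulrC -ltr_pdivlMr // HN' //; lia.
Qed.

Lemma tame_exp a k : tame abs a -> tame abs (a ^+ k).
Proof.
move=> ta; elim: k => [|k IH]; first exact: tame_1.
by rewrite exprS; apply: tame_mul.
Qed.

(** The integer factor has absolute value at most 1, and the index shift gains [1 / r]. *)
Lemma weight_der_le r a k : 0 < r -> w r (ps_der a) k <= w r a k.+1 / r.
Proof.
move=> r0; rewrite /ps_der (absM Habs) exprSr mulrA mulfK ?gt_eqF //.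
rewrite ler_pM2r ?exprn_gt0 // -[leRHS]mulr1.
by rewrite ler_wpM2l ?(abs_ge0 Habs) ?(abs_nat Habs).
Qed.

Lemma tame_der a : tame abs a -> tame abs (ps_der a : psr K).
Proof.
move=> ta r e r0 e0; have [N HN] := ta _ _ r0 (mulr_gt0 e0 r0).
exists N => k Nk; apply: le_lt_trans (weight_der_le a k r0) _.
by rewrite ltr_pdivrMr // HN // ltnW.
Qed.

Lemma mu_ps_central r a m : 0 < r -> central_index r a m -> mu_ps abs r a = w r a m.
Proof.
move=> r0 [le _]; apply/eqP; rewrite eq_le; apply/andP; split.
  by apply: ge_sup => [|_ [k _ <-]]; [exists (w r a 0), 0%N | exact: le].
apply: ub_le_sup; last by exists m.
by exists (w r a m) => _ [k _ <-]; exact: le.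
Qed.

Lemma mu_ps_le r a e : (forall k, w r a k <= e) -> mu_ps abs r a <= e.
Proof. by move=> H; apply: ge_sup => [|_ [k _ <-]//]; exists (w r a 0), 0%N. Qed.

Lemma mu_ps_0 r : mu_ps abs r (0 : psr K) = 0.
Proof.
have w0 k : w r (0 : psr K) k = 0 by rewrite ps_zeroE (abs0 Habs) mul0r.
apply/eqP; rewrite eq_le mu_ps_le => [/=|k]; last by rewrite w0.
by apply: ub_le_sup; [exists 0 => _ [k _ <-]; rewrite w0 | exists 0%N].
Qed.

Lemma mu_ps_ub r a k : 0 < r -> tame abs a -> w r a k <= mu_ps abs r a.
Proof.
move=> r0 ta; have [->|a0] := eqVneq a 0; first by rewrite mu_ps_0 ps_zeroE (abs0 Habs) mul0r.
have [m dm] := central_index_exists r0 ta a0.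
by rewrite (mu_ps_central r0 dm); case: dm.
Qed.

Lemma mu_ps_ge0 r a : 0 < r -> tame abs a -> 0 <= mu_ps abs r a.
Proof. by move=> r0 ta; apply: le_trans (mu_ps_ub 0 r0 ta); exact: weight_ge0. Qed.

Lemma mu_ps_gt0 r a : 0 < r -> tame abs a -> a != 0 -> 0 < mu_ps abs r a.
Proof.
move=> r0 ta a0; have [m dm] := central_index_exists r0 ta a0.
by rewrite (mu_ps_central r0 dm) (central_index_gt0 r0 dm).
Qed.

Lemma mu_psM r a b : 0 < r -> tame abs a -> tame abs b ->
  mu_ps abs r (a * b) = mu_ps abs r a * mu_ps abs r b.
Proof.
move=> r0 ta tb; have [->|a0] := eqVneq a 0; first by rewrite mul0r mu_ps_0 mul0r.
have [->|b0] := eqVneq b 0; first by rewrite mulr0 mu_ps_0 mulr0.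
have [m dm] := central_index_exists r0 ta a0; have [n dn] := central_index_exists r0 tb b0.
rewrite (mu_ps_central r0 dm) (mu_ps_central r0 dn).
by rewrite (mu_ps_central r0 (central_index_mul r0 dm dn)) central_index_mul_val.
Qed.

Lemma mu_ps_add r a b e : 0 < r -> tame abs a -> tame abs b ->
  mu_ps abs r a <= e -> mu_ps abs r b <= e -> mu_ps abs r (a + b) <= e.
Proof.
move=> r0 ta tb ae be; apply: mu_ps_le => k; have rk := exprn_gt0 k r0.
rewrite -ler_pdivlMr //; apply: (abs_add_le Habs); rewrite ler_pdivlMr //.
  exact: le_trans (mu_ps_ub _ r0 ta) ae.
exact: le_trans (mu_ps_ub _ r0 tb) be.
Qed.

Lemma mu_ps_opp r a : mu_ps abs r (- a) = mu_ps abs r a.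
Proof.
by rewrite /mu_ps; do 2!f_equal; apply/funext => k; rewrite ps_oppE (absN Habs).
Qed.

Lemma mu_ps_der r a : 0 < r -> tame abs a -> mu_ps abs r (ps_der a) <= mu_ps abs r a / r.
Proof.
move=> r0 ta; apply: mu_ps_le => k; apply: le_trans (weight_der_le a k r0) _.
by rewrite ler_pM2r ?invr_gt0 // mu_ps_ub.
Qed.

Lemma mu_ps_const r x : 0 < r -> mu_ps abs r (ps_const x) = abs x.
Proof.
move=> r0; have [->|x0] := eqVneq x 0; first by rewrite mu_ps_0 (abs0 Habs).
by rewrite (mu_ps_central r0 (central_index_const r0 x0)) expr0 mulr1.
Qed.

Lemma mu_ps_XsubC r z : 0 < r -> mu_ps abs r (XsubC z) = Num.max r (abs z).
Proof.
move=> r0; rewrite (mu_ps_central r0 (central_index_XsubC z r0)).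
rewrite /XsubC; have [zr|rz] := leP (abs z) r; last first.
  by rewrite /= expr0 mulr1 (absN Habs).
by rewrite /= expr1 (abs1 Habs) mul1r.
Qed.

End CentralIndex.

(** * Division by [X - z] and orders of vanishing *)

Section Division.
Variables (R : realType) (K : fieldType) (abs : K -> R).
Hypotheses (Habs : nonarch_abs abs) (Hcompl : complete_abs abs).
Implicit Types (r e : R) (x y z : K) (a b : psr K).

(** Integer factors such as binomial coefficients are harmless, and the radius [abs z + 1 >= 1]
    absorbs the index shift [k]. *)
Lemma tame_series a z k (c : nat -> nat) : tame abs a ->
  abs_cvg_to abs (fun j => (c j)%:R * a (j + k)%N * z ^+ j) 0.
Proof.
move=> ta e e0; have rho1 : 1 <= abs z + 1 by rewrite lerDr (abs_ge0 Habs).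
have rho0 : 0 < abs z + 1 by apply: lt_le_trans rho1.
have [N HN] := ta _ _ rho0 e0; exists N => j Nj; rewrite subr0.
apply: le_lt_trans (HN (j + k)%N _); last by rewrite (leq_trans Nj) ?leq_addr.
rewrite -mulrA (absM Habs) -[leRHS]mul1r ler_pM ?(abs_ge0 Habs) ?(abs_nat Habs) //.
rewrite (absM Habs) ler_wpM2l ?(abs_ge0 Habs) // (absX Habs).
apply: (@le_trans _ _ ((abs z + 1) ^+ j)).
  by apply: lerXn2r; rewrite ?nnegrE ?(abs_ge0 Habs) ?(ltW rho0) // lerDl.
by rewrite ler_weXn2l // leq_addr.
Qed.

(** The remainder is [a(z)]. The coefficients of the quotient are the tails
    [L k = sum_j a_(j+k) z^j] with [k >= 1], linked by Horner's recursion
    [L k = a k + z * L k.+1]. *)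
Lemma ps_division a z : tame abs a -> exists (b : psr K) c,
  [/\ tame abs b, a = XsubC z * b + ps_const c & series_to abs (fun j => a j * z ^+ j) c].
Proof.
move=> ta.
have conv k : exists l, series_to abs (fun j => a (j + k)%N * z ^+ j) l.
  apply: (series_cvg Habs Hcompl); have := tame_series z k (fun=> 1%N) ta.
  by under eq_fun do rewrite mul1r.
have [L HL] := choice conv.
have LS k : L k = a k + z * L k.+1.
  apply: (abs_cvg_unique Habs (HL k)) => e e0.
  have rho0 : 0 < abs z + 1 by have := abs_ge0 Habs z; lra.
  have [N HN] := HL k.+1 _ (divr_gt0 e0 rho0).
  exists N.+1 => -[//|m]; rewrite ltnS => Nm.
  rewrite big_ord_recl /= add0n expr0 mulr1 addrAC opprD addrA subrr sub0r addrC.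
  have -> : \sum_(i < m) a (bump 0 i + k)%N * z ^+ bump 0 i =
            z * \sum_(i < m) a (i + k.+1)%N * z ^+ i.
    rewrite mulr_sumr; apply: eq_bigr => i _.
    by rewrite /bump /= add1n addSnnS exprS mulrCA.
  rewrite -mulrBr (absM Habs); have := HN m Nm; rewrite ltr_pdivlMr // mulrC.
  apply: le_lt_trans; rewrite ler_wpM2r ?(abs_ge0 Habs) //; lra.
exists (fun k => L k.+1), (L 0%N); split=> [r e r0 e0|| ].
(* This radius dominates [r], [abs z] and 1, so one bound on the coefficients of [a] controls all
   terms of a tail. Halving [e] restores strictness after the limit. *)
- have rho0 : 0 < r + abs z + 1 by have := abs_ge0 Habs z; lra.
  have e2 : 0 < e / 2 by lra.
  have [N HN] := ta _ _ rho0 e2; exists N => k Nk.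
  have rhok := exprn_gt0 k rho0.
  suff : abs (L k.+1) <= e / 2 / (r + abs z + 1) ^+ k.
    rewrite ler_pdivlMr // => H; suff : abs (L k.+1) * r ^+ k <= e / 2 by lra.
    apply: le_trans H; rewrite ler_wpM2l ?(abs_ge0 Habs) //.
    apply: lerXn2r; rewrite ?nnegrE ?ltW //; have := abs_ge0 Habs z; lra.
  apply: (abs_cvg_le Habs (N := 0) _ (HL k.+1)) => [|n _]; first exact: divr_gt0.
  apply: (abs_sum_le Habs) => [|i _]; first by rewrite ltW ?divr_gt0.
  rewrite ler_pdivlMr // (absM Habs) (absX Habs) -mulrA.
  apply: le_trans (ltW (HN (i + k.+1)%N _)); last by lia.
  rewrite ler_wpM2l ?(abs_ge0 Habs) // -addSnnS exprD ler_wpM2r ?(ltW rhok) //.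
  apply: (@le_trans _ _ ((r + abs z + 1) ^+ i)).
    apply: lerXn2r; rewrite ?nnegrE ?(abs_ge0 Habs) ?(ltW rho0) //; have := abs_ge0 Habs z; lra.
  by rewrite ler_weXn2l //; have := abs_ge0 Habs z; lra.
- apply/funext => -[|k]; rewrite ps_addE ?XsubC_mul0 ?XsubC_mulS /ps_const /=.
    by rewrite [L 0%N]LS; ring.
  by rewrite [L k.+1]LS; ring.
- have E : (fun j => a (j + 0)%N * z ^+ j) = (fun j => a j * z ^+ j).
    by apply/funext => j; rewrite addn0.
  by have := HL 0%N; rewrite E.
Qed.

(** Divisibility replaces evaluation so that orders and products are handled algebraically;
    [vanishesP] relates the two. *)
Definition vanishes z a : Prop := exists2 b : psr K, tame abs b & a = XsubC z * b.

(** At radius [abs z + 1] a nonzero multiple of [X - z] has positive central index, while a nonzero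
    constant has index 0. *)
Lemma XsubC_mul_const z b x : tame abs b -> XsubC z * b = ps_const x -> x = 0.
Proof.
move=> tb E; apply/eqP; apply: contraT => x0.
have r0 : 0 < abs z + 1 by have := abs_ge0 Habs z; lra.
have d0 := central_index_const Habs r0 x0.
have [b0|b0] := eqVneq b 0.
  have := central_index_neq0 Habs r0 d0; rewrite -E b0 mulr0 eqxx //.
have [m dm] := central_index_exists Habs r0 tb b0.
have := central_index_mul Habs r0 (central_index_XsubC Habs z r0) dm.
rewrite E lerDl ler01 /= => d1; by have := central_index_uniq d0 d1.
Qed.

Lemma vanishesP z a : tame abs a ->
  vanishes z a <-> series_to abs (fun j => a j * z ^+ j) 0.
Proof.
move=> ta; have [b [c [tb E cv]]] := ps_division z ta; split=> [[b' tb' E']|cv0].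
  suff c0 : c = 0 by rewrite -c0.
  apply: (@XsubC_mul_const z (b' - b)); first exact: (tame_sub Habs).
  by rewrite mulrBr -E' E addrAC subrr add0r.
exists b => //; rewrite E (abs_cvg_unique Habs cv cv0).
by rewrite ps_const0 addr0.
Qed.

Lemma vanishes_at0 a : tame abs a -> a 0%N = 0 -> vanishes 0 a.
Proof.
move=> ta a0; apply/vanishesP => // e e0; exists 1%N => -[//|n] _.
rewrite big_ord_recl /= a0 mul0r big1 ?addr0 ?subr0 ?(abs0 Habs) // => i _.
by rewrite exprS mul0r mulr0.
Qed.

Lemma vanishes_mul z a b : tame abs a -> tame abs b ->
  vanishes z (a * b) -> vanishes z a \/ vanishes z b.
Proof.
move=> ta tb [q tq E].
have [a1 [c [ta1 Ea _]]] := ps_division z ta; have [b1 [d [tb1 Eb _]]] := ps_division z tb.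
have cd : ps_const (c * d) = (ps_const c : psr K) * ps_const d.
  apply/funext => -[|k]; first by rewrite ps_mulE big_ord1.
  by rewrite ps_mulE big_ord_recl big1 ?mulr0 ?addr0 // => i _; rewrite mul0r.
(* Modulo [X - z] the product [a * b] is the constant [c * d], which is thus a multiple of
   [X - z]. *)
have : c * d = 0.
  apply: (@XsubC_mul_const z (q - (a1 * b + (ps_const c : psr K) * b1))).
    apply: (tame_sub Habs) => //; apply: (tame_add Habs); apply: (tame_mul Habs) => //.
    exact: (tame_const Habs).
  by rewrite cd mulrBr -E Eb Ea; ring.
move=> /eqP; rewrite mulf_eq0 => /orP[] /eqP x0; [left; exists a1|right; exists b1] => //.
  by rewrite Ea x0 ps_const0 addr0.
by rewrite Eb x0 ps_const0 addr0.
Qed.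

Definition order_at z a m : Prop :=
  exists b : psr K, [/\ tame abs b, a = XsubC z ^+ m * b & ~ vanishes z b].

Lemma not_vanishes_const z x : x != 0 -> ~ vanishes z (ps_const x).
Proof. by move=> x0 [b tb /esym /(XsubC_mul_const tb) /eqP]; rewrite (negbTE x0). Qed.

Lemma XsubC_neq0 z : XsubC z != 0 :> psr K.
Proof. by apply/ps_neq0P; exists 1%N; rewrite /XsubC /= oner_eq0. Qed.

(** Induction on the central index at a radius whose disc contains [z]: each division by [X - z]
    lowers it by one. *)
Lemma order_at_exists z a : tame abs a -> a != 0 -> exists m, order_at z a m.
Proof.
move=> ta a0; have r0 : 0 < abs z + 1 by have := abs_ge0 Habs z; lra.
have [k dk] := central_index_exists Habs r0 ta a0.
elim: k => [|k IH] in a ta a0 dk *; have [[b tb E]|nv] := pselect (vanishes z a).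
- have b0 : b != 0 by apply: contraNneq a0 => b0; rewrite E b0 mulr0.
  have [m dm] := central_index_exists Habs r0 tb b0.
  have := central_index_mul Habs r0 (central_index_XsubC Habs z r0) dm.
  by rewrite -E lerDl ler01 /= => /(central_index_uniq dk).
- by exists 0%N, a; rewrite expr0 mul1r.
- have b0 : b != 0 by apply: contraNneq a0 => b0; rewrite E b0 mulr0.
  have [m dm] := central_index_exists Habs r0 tb b0.
  have := central_index_mul Habs r0 (central_index_XsubC Habs z r0) dm.
  rewrite -E lerDl ler01 /= add1n => /(central_index_uniq dk) [km].
  have [|n [c [tc Eb nc]]] := IH b tb b0; first by rewrite km.
  by exists n.+1, c; split=> //; rewrite exprS -mulrA -Eb.
- by exists 0%N, a; rewrite expr0 mul1r.
Qed.

Lemma order_at_mul z a b m n : order_at z a m -> order_at z b n -> order_at z (a * b) (m + n).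
Proof.
move=> [a1 [ta1 -> na]] [b1 [tb1 -> nb]]; exists (a1 * b1); split.
- exact: (tame_mul Habs).
- by rewrite exprD; ring.
- by move=> /(vanishes_mul ta1 tb1) [].
Qed.

Lemma taylor_coef_eq a z k v :
  series_to abs (fun j => 'C(j + k, k)%:R * a (j + k)%N * z ^+ j) v -> taylor_coef abs a z k = v.
Proof.
move=> H; apply: xget_unique => // v' H'; exact: (abs_cvg_unique Habs H' H).
Qed.

Lemma taylor_coef_series a z k : tame abs a ->
  series_to abs (fun j => 'C(j + k, k)%:R * a (j + k)%N * z ^+ j) (taylor_coef abs a z k).
Proof.
move=> ta; have [v Hv] := series_cvg Habs Hcompl (tame_series z k (fun j => 'C(j + k, k)) ta).
by rewrite (taylor_coef_eq Hv).
Qed.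

Lemma taylor_coef0 a z : tame abs a -> taylor_coef abs a z 0 = 0 <-> vanishes z a.
Proof.
move=> ta; rewrite (vanishesP z ta); have := taylor_coef_series z 0 ta.
have -> : (fun j => 'C(j + 0, 0)%:R * a (j + 0)%N * z ^+ j) = (fun j => a j * z ^+ j).
  by apply/funext => j; rewrite bin0 mul1r addn0.
move=> H; split=> [<-//|H0]; exact: (abs_cvg_unique Habs H H0).
Qed.

(** The bridge between divisibility by [X - z] and the Taylor coefficients through which [zord] is
    defined. *)
Lemma taylor_coef_XsubC b z k : tame abs b ->
  taylor_coef abs (XsubC z * b) z k.+1 = taylor_coef abs b z k.
Proof.
move=> tb; apply: taylor_coef_eq; apply: (abs_cvg_sub_null Habs (taylor_coef_series z k tb)).
(* By Pascal's rule the difference of the two partial sums telescopes to [- t n], which tends to 0;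
   the other end [t 0] contains a vanishing binomial. *)
pose t n : K := 'C(n + k, k.+1)%:R * b (n + k)%N * z ^+ n.
have E n : \sum_(i < n) 'C(i + k.+1, k.+1)%:R * (XsubC z * b) (i + k.+1)%N * z ^+ i
    - \sum_(i < n) 'C(i + k, k)%:R * b (i + k)%N * z ^+ i = - t n.
  elim: n => [|n IH]; first by rewrite !big_ord0 /t add0n bin_small // !mul0r subr0 oppr0.
  rewrite !big_ord_recr /= opprD addrACA IH /t addnS XsubC_mulS addSn binS natrD exprS; ring.
move=> e e0; have [N HN] := tame_series z k (fun j => 'C(j + k, k.+1)) tb e0.
by exists N => n /HN; rewrite !subr0 E (absN Habs).
Qed.

End Division.

(** * Zeros of entire functions *)

Section Zeros.
Variables (R : realType) (K : closedFieldType) (abs : K -> R).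
Hypotheses (Habs : nonarch_abs abs) (Hcompl : complete_abs abs).
Implicit Types (r e : R) (x y z : K) (a b : psr K).

Definition ps_poly (p : {poly K}) : psr K := fun k => p`_k.

Lemma ps_polyM p q : ps_poly (p * q) = ps_poly p * ps_poly q.
Proof. by apply/funext => k; rewrite ps_mulE /ps_poly coefM. Qed.

Lemma ps_polyC x : ps_poly x%:P = ps_const x.
Proof. by apply/funext => k; rewrite /ps_poly coefC. Qed.

Lemma ps_polyXsubC x : ps_poly ('X - x%:P) = XsubC x.
Proof.
apply/funext => -[|[|k]]; rewrite /ps_poly coefB coefX coefC /XsubC /=.
- by rewrite sub0r.
- by rewrite subr0.
- by rewrite subr0.
Qed.

Lemma central_index_poly r (p : {poly K}) x (s : seq K) : 0 < r -> x != 0 ->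
  p = x *: \prod_(w <- s) ('X - w%:P) ->
  central_index abs r (ps_poly p) (count (fun w => abs w <= r) s).
Proof.
move=> r0 x0 ->; rewrite -mul_polyC ps_polyM ps_polyC -[count _ _]add0n.
apply: (central_index_mul Habs r0); first exact: (central_index_const Habs).
elim: s => [|w s IH] /=; first by rewrite big_nil ps_polyC; exact: (central_index_1 Habs).
rewrite big_cons ps_polyM ps_polyXsubC; apply: (central_index_mul Habs r0) => //.
exact: (central_index_XsubC Habs).
Qed.

Lemma seq_argmin (T : eqType) (F : T -> R) (s : seq T) : s != [::] ->
  exists2 x : T, x \in s & forall y : T, y \in s -> F x <= F y.
Proof.
elim: s => // x s IH _; have [->|/IH [y ys Hy]] := eqVneq s [::].
  by exists x; rewrite ?mem_head // => y; rewrite inE => /eqP ->.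
have [xy|/ltW yx] := leP (F x) (F y).
  exists x; rewrite ?mem_head // => u; rewrite inE => /orP[/eqP -> //|/Hy].
  exact: le_trans.
by exists y => [|u]; rewrite inE ?ys ?orbT // => /orP[/eqP ->//|/Hy].
Qed.

(** A root beyond [r] satisfies [abs (z - w) = abs w]; one within [r] has [abs w <= r] and lies at
    distance at least [e]. Comparing [|p(0)|] with [|p(z)|] in this way bounds the distance from [z]
    to the nearest root. *)
Lemma horner_prod_lower r e (s : seq K) z : 0 < r -> 0 <= e -> abs z <= r ->
  (forall w, w \in s -> abs w <= r -> e <= abs (z - w)) ->
  (\prod_(w <- s) abs w) * e ^+ count (fun w => abs w <= r) s <=
  (\prod_(w <- s) abs (z - w)) * r ^+ count (fun w => abs w <= r) s.
Proof.
move=> r0 e0 zr; elim: s => [|w s IH] H /=; first by rewrite !big_nil.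
have {}IH := IH (fun v vs => H v (@mem_behead _ (w :: s) v vs)).
rewrite !big_cons !exprD [leLHS]mulrACA [leRHS]mulrACA; apply: ler_pM => //.
- by rewrite mulr_ge0 ?exprn_ge0 ?(abs_ge0 Habs).
- rewrite mulr_ge0 ?exprn_ge0 ?(abs_ge0 Habs) ?prodr_ge0 // => i _; exact: (abs_ge0 Habs).
have [wr|rw] := leP (abs w) r; rewrite /= ?expr0 ?expr1 ?mulr1; last first.
  by rewrite (abs_add_eq Habs) (absN Habs) // (le_lt_trans zr).
by rewrite mulrC ler_pM ?(abs_ge0 Habs) ?H ?mem_head.
Qed.

Lemma ps_trunc_neq0 a n : a 0%N != 0 -> (0 < n)%N -> ps_trunc n a != 0.
Proof.
move=> a0 n0; apply: contraNneq a0 => /(congr1 (fun q : {poly K} => q`_0)).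
by rewrite coef_poly n0 coef0 => ->.
Qed.

(** Truncating above the central index discards only strictly smaller terms, so every later
    truncation has the same number of roots in the disc. *)
Lemma count_trunc_roots r a m n (s : seq K) : 0 < r -> central_index abs r a m ->
  (m < n)%N -> a 0%N != 0 ->
  ps_trunc n a = lead_coef (ps_trunc n a) *: \prod_(w <- s) ('X - w%:P) ->
  count (fun w => abs w <= r) s = m.
Proof.
move=> r0 [lea lta] mn a0 Es.
have pn0 : ps_trunc n a != 0 by apply: ps_trunc_neq0 => //; apply: leq_ltn_trans mn.
have := central_index_poly r0 (_ : lead_coef (ps_trunc n a) != 0) Es.
rewrite lead_coef_eq0 => /(_ pn0) ci; apply: (central_index_uniq ci).
rewrite /central_index /ps_poly !coef_poly mn.
split=> j; [rewrite coef_poly|move=> mj; rewrite coef_poly].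
  by case: ifP => // _; rewrite (abs0 Habs) mul0r (weight_ge0 Habs).
case: ifP => _; first exact: lta.
rewrite (abs0 Habs) mul0r; apply: le_lt_trans (lta _ (ltnSn m)); exact: (weight_ge0 Habs).
Qed.

(** As [z] is a root of one truncation, the next takes the value [a_n z^n] there. This small value
    bounds the distance to the nearest of its [m] roots in the disc, to the power [m] because the
    other roots are at least as far. *)
Lemma ps_trunc_root_next r a m n z : 0 < r -> a 0%N != 0 ->
  central_index abs r a m -> (0 < m < n)%N ->
  root (ps_trunc n a) z -> abs z <= r ->
  exists z', [/\ root (ps_trunc n.+1 a) z', abs z' <= r &
    abs (a 0%N) * abs (z' - z) ^+ m <= abs (a n) * r ^+ n * r ^+ m].
Proof.
move=> r0 a0 ci /andP[m0 mn] /rootP pz zr.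
set p := ps_trunc n.+1 a.
have pn0 : p != 0 by exact: ps_trunc_neq0.
have p0 : p`_0 = a 0%N by rewrite coef_poly.
have [s Es] := closed_field_poly_normal p.
have := count_trunc_roots r0 ci (leqW mn) a0 Es; set c := count _ s => cm.
have fs : [seq w <- s | abs w <= r] != [::].
  by rewrite -size_eq0 size_filter -/c cm -lt0n.
have [z' z's Hz'] := seq_argmin (fun w => abs (z - w)) fs.
move: z's; rewrite mem_filter => /andP[z'r z's]; exists z'; split=> //.
  rewrite Es rootZ ?lead_coef_eq0 // root_prod_XsubC //.
have pz1 : p.[z] = a n * z ^+ n.
  rewrite /p /ps_trunc horner_poly big_ord_recr /=.
  by move: pz; rewrite /ps_trunc horner_poly => ->; rewrite add0r.
have absprod (t : K) : abs p.[t] = abs (lead_coef p) * \prod_(w <- s) abs (t - w).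
  rewrite {1}Es hornerZ (absM Habs) horner_prod; congr (_ * _).
  rewrite (big_morph abs (absM Habs) (abs1 Habs)); apply: eq_bigr => w _.
  by rewrite hornerXsubC.
have a0E : abs (a 0%N) = abs (lead_coef p) * \prod_(w <- s) abs w.
  rewrite -p0 -horner_coef0 absprod; congr (_ * _); apply: eq_bigr => w _.
  by rewrite sub0r (absN Habs).
have := @horner_prod_lower r (abs (z - z')) s z r0 (abs_ge0 Habs _) zr.
rewrite -/c cm => H; rewrite a0E (absB Habs z') -mulrA.
apply: (@le_trans _ _ (abs p.[z] * r ^+ m)); last first.
  rewrite pz1 (absM Habs) (absX Habs) ler_wpM2r ?exprn_ge0 ?(ltW r0) //.
  rewrite ler_wpM2l ?(abs_ge0 Habs) //.
  by apply: lerXn2r; rewrite ?nnegrE ?(abs_ge0 Habs) ?(ltW r0).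
rewrite absprod -mulrA ler_wpM2l ?(abs_ge0 Habs) // H // => w ws wr.
by apply: Hz'; rewrite mem_filter wr.
Qed.

Lemma abs_pow_sub r z x k : 0 < r -> abs z <= r -> abs x <= r ->
  abs (z ^+ k - x ^+ k) * r <= abs (z - x) * r ^+ k.
Proof.
move=> r0 zr xr; case: k => [|k]; first by rewrite !expr0 subrr (abs0 Habs) mul0r mulr1 (abs_ge0 Habs).
rewrite subrXX (absM Habs) exprSr mulrA ler_wpM2r ?(ltW r0) // ler_wpM2l ?(abs_ge0 Habs) //.
apply: (abs_sum_le Habs) => [|i _]; first by rewrite exprn_ge0 ?ltW.
rewrite (absM Habs) !(absX Habs).
apply: (@le_trans _ _ (r ^+ (k - i) * r ^+ i)); last by rewrite -exprD subnK // -ltnS.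
rewrite ler_pM ?exprn_ge0 ?(abs_ge0 Habs) //.
  by apply: lerXn2r; rewrite ?nnegrE ?(abs_ge0 Habs) ?(ltW r0).
by apply: lerXn2r; rewrite ?nnegrE ?(abs_ge0 Habs) ?(ltW r0).
Qed.

Lemma zero_exists r a m : 0 < r -> tame abs a -> central_index abs r a m -> (0 < m)%N ->
  exists2 z, abs z <= r & vanishes abs z a.
Proof.
move=> r0 ta ci m0; have [a0|a0] := eqVneq (a 0%N) 0.
  exists 0; first by rewrite (abs0 Habs) ltW.
  exact: (vanishes_at0 Habs Hcompl).
have ra : 0 < abs (a 0%N) by rewrite (abs_gt0 Habs).
pose good n z := root (ps_trunc n a) z /\ abs z <= r.
pose step (x : nat * K) z' := (m < x.1)%N -> good x.1 x.2 -> good x.1.+1 z' /\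
  abs (a 0%N) * abs (z' - x.2) ^+ m <= abs (a x.1) * r ^+ x.1 * r ^+ m.
have /choice [g Hg] : forall x : nat * K, exists z', step x z'.
  move=> [n z]; have [mn|nm] := ltnP m n; last by exists 0; rewrite /step ltnNge nm.
  have [[zr zd]|ng] := pselect (good n z); last by exists 0 => _ /ng.
  have [|z' [? ? ?]] := ps_trunc_root_next r0 a0 ci _ zr zd; first by rewrite m0.
  by exists z'.
have [z0 gz0] : exists z0, good m.+1 z0.
  have pn0 := ps_trunc_neq0 a0 (ltn0Sn m).
  have [s Es] := closed_field_poly_normal (ps_trunc m.+1 a).
  have cm := count_trunc_roots r0 ci (ltnSn m) a0 Es.
  have : has (fun w => abs w <= r) s by rewrite has_count cm.
  case/hasP => z0 z0s z0r; exists z0; split=> //.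
  by rewrite Es rootZ ?lead_coef_eq0 // root_prod_XsubC.
pose X k := iter k (fun x : nat * K => (x.1.+1, g x)) (m.+1, z0).
have X1 k : (X k).1 = (m.+1 + k)%N by elim: k => [|k IH] /=; rewrite ?addn0 // IH addnS.
have Xg k : good (X k).1 (X k).2.
  by elim: k => [//|k IH] /=; have [] := Hg (X k) _ IH; rewrite ?X1 ?ltnS ?leq_addr.
pose u k := (X k).2.
have ur k : abs (u k) <= r by case: (Xg k).
have [z Hz] : exists z, abs_cvg_to abs u z.
  apply: Hcompl; apply: (abs_cauchy_succ Habs) => e e0.
  have rm := exprn_gt0 m r0; have em := exprn_gt0 m e0.
  (* Chosen so that the nearest-root estimate yields [abs (u k.+1 - u k) ^+ m < e ^+ m]. *)
  have e'0 : 0 < abs (a 0%N) * e ^+ m / r ^+ m by rewrite divr_gt0 ?mulr_gt0.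
  have [N HN] := ta _ _ r0 e'0; exists N => k Nk.
  have [|_ H] := Hg (X k) _ (Xg k); first by rewrite X1 ltnS leq_addr.
  have : abs (a 0%N) * abs (u k.+1 - u k) ^+ m < abs (a 0%N) * e ^+ m.
    apply: (le_lt_trans H); rewrite -ltr_pdivlMr // HN // X1.
    by apply: (leq_trans Nk); rewrite leq_addl.
  rewrite ltr_pM2l // => lt_m; rewrite ltNge; apply/negP => ge.
  have : e ^+ m <= abs (u k.+1 - u k) ^+ m.
    by apply: lerXn2r; rewrite ?nnegrE ?(abs_ge0 Habs) ?(ltW e0).
  by rewrite leNgt lt_m.
have zr : abs z <= r by apply: (abs_cvg_le Habs (N := 0) r0 Hz) => k _.
exists z => //; apply/(vanishesP Habs Hcompl) => // e e0.
have [M M0 HM] := tame_bounded Habs r0 ta.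
have [N HN] := Hz _ (divr_gt0 (mulr_gt0 e0 r0) M0).
exists (m.+1 + N)%N => n mNn; rewrite subr0.
have [k nE Nk] : exists2 k, n = (m.+1 + k)%N & (N <= k)%N by exists (n - m.+1)%N; lia.
(* The truncation vanishes at [u k], so the partial sum at [z] equals its difference with the one at
   [u k], which [abs (z - u k)] controls uniformly in [n]. *)
have [/rootP] := Xg k; rewrite X1 -nE horner_poly -/(u k) => su _.
rewrite -[\sum_(i < n) a i * z ^+ i]subr0 -[X in _ - X]su -sumrB.
have lt1 : abs (u k - z) * M / r < e.
  by rewrite ltr_pdivrMr // -ltr_pdivlMr // HN.
apply: le_lt_trans lt1; apply: (abs_sum_le Habs) => [|i _].
  by rewrite divr_ge0 ?mulr_ge0 ?(abs_ge0 Habs) ?ltW.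
rewrite -mulrBr ler_pdivlMr // (absM Habs) -mulrA.
apply: (@le_trans _ _ (abs (a i) * (abs (z - u k) * r ^+ i))).
  by rewrite ler_wpM2l ?(abs_ge0 Habs) // abs_pow_sub.
by rewrite mulrCA (absB Habs z) ler_wpM2l ?(abs_ge0 Habs).
Qed.

(** Index 0 means that the constant term strictly dominates, and the other weights only decrease
    with the radius. *)
Lemma zero_free_shrink r r' a : 0 < r' -> r' <= r ->
  central_index abs r a 0 -> central_index abs r' a 0.
Proof.
move=> r'0 r'r [le lt]; have wle j : abs (a j) * r' ^+ j <= abs (a j) * r ^+ j.
  rewrite ler_wpM2l ?(abs_ge0 Habs) //; apply: lerXn2r => //; rewrite nnegrE ltW //.
  exact: lt_le_trans r'r.
rewrite /central_index; split=> j; first exact: le_trans (wle j) (le j).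
move=> /lt; exact: le_lt_trans.
Qed.

Lemma zero_free_not_vanishes r a z : 0 < r -> central_index abs r a 0 -> abs z <= r ->
  ~ vanishes abs z a.
Proof.
move=> r0 ci zr [b tb E]; have [b0|b0] := eqVneq b 0.
  by have := central_index_neq0 Habs r0 ci; rewrite E b0 mulr0 eqxx.
have [m dm] := central_index_exists Habs r0 tb b0.
have := central_index_mul Habs r0 (central_index_XsubC Habs z r0) dm.
by rewrite -E zr => /(central_index_uniq ci).
Qed.

(** Induction on the central index: while it is positive there is a zero in the disc, whose removal
    lowers it by one. *)
Lemma disc_factorization r a : 0 < r -> tame abs a -> a != 0 -> exists s (U : psr K),
  [/\ all (fun z => abs z <= r) s, tame abs U, central_index abs r U 0 &
      a = (\prod_(z <- s) XsubC z) * U].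
Proof.
move=> r0 ta a0; have [k dk] := central_index_exists Habs r0 ta a0.
elim: k => [|k IH] in a ta a0 dk *.
  by exists [::], a; rewrite big_nil mul1r.
have [//|z zr [b tb E]] := zero_exists r0 ta dk.
have b0 : b != 0 by apply: contraNneq a0 => b0; rewrite E b0 mulr0.
have [m dm] := central_index_exists Habs r0 tb b0.
have := central_index_mul Habs r0 (central_index_XsubC Habs z r0) dm.
rewrite -E zr add1n => /(central_index_uniq dk) [km].
have [|s [U [sr tU cU Eb]]] := IH b tb b0; first by rewrite km.
by exists (z :: s), U; rewrite /= zr sr big_cons -mulrA -Eb.
Qed.

Lemma order_at_XsubC z x : order_at abs z (XsubC x) (x == z).
Proof.
have [->|xz] := eqVneq x z.
  exists 1; rewrite expr1 mulr1; split=> //; first exact: (tame_1 Habs).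
  by apply: (not_vanishes_const Habs); rewrite oner_eq0.
exists (XsubC x); rewrite expr0 mul1r; split=> //; first exact: (tame_XsubC Habs).
move=> [b tb E]; have : z - x = 0.
  apply: (@XsubC_mul_const _ _ _ Habs z (b - 1)).
    by apply: (tame_sub Habs) => //; exact: (tame_1 Habs).
  rewrite mulrBr -E mulr1; apply/funext => -[|[|k]]; rewrite ps_addE ps_oppE /XsubC /ps_const /=.
  - ring.
  - by rewrite subrr.
  - by rewrite subrr.
by move/eqP; rewrite subr_eq0 eq_sym (negbTE xz).
Qed.

Lemma order_at_factorization r s (U : psr K) z : 0 < r -> tame abs U ->
  central_index abs r U 0 -> abs z <= r ->
  order_at abs z ((\prod_(z <- s) XsubC z) * U) (count_mem z s).
Proof.
move=> r0 tU cU zr; rewrite -[count_mem z s]addn0; apply: (order_at_mul Habs Hcompl).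
  elim: s => [|x s IH] /=.
    rewrite big_nil; exists 1; rewrite expr0 mulr1; split=> //; first exact: (tame_1 Habs).
    by apply: (not_vanishes_const Habs); rewrite oner_eq0.
  by rewrite big_cons; apply: (order_at_mul Habs Hcompl) => //; exact: order_at_XsubC.
by exists U; rewrite expr0 mul1r; split=> //; exact: zero_free_not_vanishes zr.
Qed.

Lemma order_at_zord z a m : order_at abs z a m -> zord abs a z = m.
Proof.
move=> [b [tb E nb]].
have tay k : tame abs (XsubC z ^+ k * b).
  by apply: (tame_mul Habs) => //; apply: (tame_exp Habs); exact: (tame_XsubC Habs).
(* Each factor [X - z] shifts the Taylor coefficients at [z] by one place. *)
have T k j : taylor_coef abs (XsubC z ^+ k * b) z j =
    if (j < k)%N then 0 else taylor_coef abs b z (j - k).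
  elim: k j => [|k IH] j; first by rewrite expr0 mul1r subn0.
  rewrite exprS -mulrA; case: j => [|j].
    by apply/(taylor_coef0 Habs Hcompl); [apply: (tame_mul Habs) => //; exact: (tame_XsubC Habs) | exists (XsubC z ^+ k * b)].
  by rewrite (taylor_coef_XsubC Habs Hcompl) // IH ltnS subSS.
have Tm : taylor_coef abs a z m != 0.
  by rewrite E T ltnn subnn; apply/eqP => /(taylor_coef0 Habs Hcompl z tb).
apply: xget_unique => /= [|j [lt jn]].
  by split=> // k km; rewrite E T km.
case: (ltngtP j m) => // [jm|/lt /eqP]; last by rewrite (negbTE Tm).
by move: jn; rewrite E T jm eqxx.
Qed.

(** [S] may contain more than the zeros: points of order 0 add nothing, which lets several functions
    share one list. *)
Definition covers_zeros r a (S : seq K) : Prop :=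
  [/\ uniq S, all (fun z => abs z <= r) S &
      forall z, abs z <= r -> vanishes abs z a -> z \in S].

Lemma covers_zeros_exists r a : 0 < r -> tame abs a -> a != 0 ->
  exists S, covers_zeros r a S.
Proof.
move=> r0 ta a0; have [s [U [sr tU cU E]]] := disc_factorization r0 ta a0.
exists (undup s); split; first exact: undup_uniq.
  by apply/allP => z; rewrite mem_undup => /(allP sr).
move=> z zr va; rewrite mem_undup -has_pred1 has_count lt0n; apply/eqP => c0.
have := order_at_factorization s r0 tU cU zr; rewrite c0 -E => -[b [tb Eb nb]].
by apply: nb; rewrite -[b]mul1r -[1](expr0 (XsubC z)) -Eb.
Qed.

(** The contribution of a zero [z] with [abs z <= r] to the growth of [ln mu] from radius 1 to
    radius [r]. *)
Definition log_ratio r z : R := ln r - ln (Num.max 1 (abs z)).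

Lemma sum_count (S s : seq K) (F : K -> R) : uniq S -> {subset s <= S} ->
  \sum_(z <- s) F z = \sum_(z <- S) (count_mem z s)%:R * F z.
Proof.
move=> uS; elim: s => [|x s IH] sS.
  by rewrite big_nil big1 // => z _; rewrite mul0r.
rewrite big_cons IH; last by move=> y ys; apply: sS; rewrite inE ys orbT.
have xS : x \in S by apply: sS; rewrite mem_head.
rewrite (bigD1_seq x) //= [RHS](bigD1_seq x) //= eqxx natrD mulrDl mul1r addrA.
by congr (_ + _); apply: eq_bigr => z zx; rewrite eq_sym (negbTE zx).
Qed.

(* Poisson-Jensen; normalising at radius 1 instead of by the lowest coefficient
   avoids a separate treatment of a zero at the origin. *)
Lemma jensen r a S : 1 <= r -> tame abs a -> a != 0 -> covers_zeros r a S ->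
  ln (mu_ps abs r a) - ln (mu_ps abs 1 a) = \sum_(z <- S) (zord abs a z)%:R * log_ratio r z.
Proof.
move=> r1 ta a0 [uS Sr cS]; have r0 : 0 < r by apply: lt_le_trans r1.
have [s [U [sr tU cU E]]] := disc_factorization r0 ta a0.
have ord z : abs z <= r -> zord abs a z = count_mem z s.
  move=> zr; rewrite E; apply: order_at_zord; exact: (order_at_factorization (r := r)).
have sS : {subset s <= S}.
  move=> z zs; apply: cS; first exact: (allP sr).
  rewrite E (big_rem z) //= -mulrA; exists ((\prod_(y <- rem z s) XsubC y) * U) => //.
  apply: (tame_mul Habs) => //; apply: (big_ind (tame abs)); first exact: (tame_1 Habs).
    exact: (tame_mul Habs).
  by move=> y _; exact: (tame_XsubC Habs).
transitivity (\sum_(z <- s) log_ratio r z); last first.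
  rewrite (sum_count _ uS sS); apply: eq_big_seq => z zS.
  by rewrite ord // (allP Sr).
(* One formula for all radii up to [r], applied at [r] and at 1: the zero-free factor contributes
   the same constant [abs (U 0%N)] at both, so it cancels. *)
have mu r' : 0 < r' -> r' <= r ->
    ln (mu_ps abs r' a) = \sum_(z <- s) ln (Num.max r' (abs z)) + ln (abs (U 0%N)).
  move=> r'0 r'r; have cU' := zero_free_shrink r'0 r'r cU.
  have U0 : 0 < abs (U 0%N) by have := central_index_gt0 Habs r'0 cU'; rewrite expr0 mulr1.
  have tprod (q : seq K) : tame abs (\prod_(z <- q) XsubC z : psr K).
    apply: (big_ind (tame abs)); first exact: (tame_1 Habs).
      exact: (tame_mul Habs).
    by move=> y _; exact: (tame_XsubC Habs).
  have nprod (q : seq K) : 0 < mu_ps abs r' (\prod_(z <- q) XsubC z : psr K) /\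
    ln (mu_ps abs r' (\prod_(z <- q) XsubC z : psr K)) = \sum_(z <- q) ln (Num.max r' (abs z)).
    elim: q => [|z q [IH1 IH2]].
      rewrite !big_nil (mu_ps_central r'0 (central_index_1 Habs r'0)).
      by rewrite expr0 mulr1 (abs1 Habs) ln1.
    rewrite !big_cons (mu_psM Habs) //; last exact: (tame_XsubC Habs).
    rewrite (mu_ps_XsubC Habs) //; have M0 : 0 < Num.max r' (abs z) by rewrite lt_max r'0.
    by rewrite mulr_gt0 // lnM ?posrE // IH2.
  rewrite E (mu_psM Habs) // (mu_ps_central r'0 cU') expr0 mulr1.
  by have [n0 nE] := nprod s; rewrite lnM ?posrE // nE.
rewrite (mu r) // (mu 1) // opprD addrACA subrr addr0 -sumrB.
rewrite big_seq [RHS]big_seq; apply: eq_bigr => z zs; rewrite /log_ratio.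
by rewrite max_l // (allP sr).
Qed.

End Zeros.

(** * Counting functions *)

Section Counting.
Variable R : realType.
Local Notation leb := (@lebesgue_measure R).

Lemma integral_inv (x r : R) : 0 < x -> x <= r ->
  (\int[leb]_(t in `[x, r]) (t^-1)%:E = (ln r - ln x)%:E)%E.
Proof.
move=> x0; rewrite le_eqVlt => /orP[/eqP <-|xr].
  by rewrite set_itv1 integral_set1 subrr.
rewrite EFinB; apply: continuous_FTC2 => //.
- apply: continuous_in_subspaceT => t; rewrite inE /= in_itv /= => /andP[xt _].
  by apply: inv_continuous; rewrite gt_eqF // (lt_le_trans x0).
- split.
  + move=> t; rewrite in_itv /= => /andP[xt _]; apply: ex_derive.
    by apply: is_derive1_ln; exact: lt_trans xt.
  + by apply: cvg_at_right_filter; apply: continuous_ln.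
  + by apply: cvg_at_left_filter; apply: continuous_ln; exact: lt_trans xr.
- move=> t; rewrite in_itv /= => /andP[xt _]; rewrite derive1E.
  by have [_ ->] := is_derive1_ln (lt_trans x0 xt).
Qed.

Lemma measurable_inv_itv (x r : R) : 0 < x ->
  measurable_fun (`[x, r]%classic : set R) (EFin \o @GRing.inv R).
Proof.
move=> x0; apply: measurableT_comp => //.
apply: subspace_continuous_measurable_fun => //.
apply: continuous_in_subspaceT => t; rewrite inE /= in_itv /= => /andP[xt _].
by apply: inv_continuous; rewrite gt_eqF // (lt_le_trans x0).
Qed.

(** Each jump at [v z] contributes the integral of [1 / t] over [[v z, r]]; nonnegativity lets sum
    and integral be exchanged. *)
Lemma Rintegral_jumps (T : eqType) (S : seq T) (w : T -> nat) (v : T -> R) (r : R) :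
  (forall z, 0 < v z) -> (forall z, z \in S -> v z <= r) ->
  Rintegral leb `[0, r] (fun t => (\sum_(z <- S | v z <= t) (w z)%:R) / t) =
  \sum_(z <- S) (w z)%:R * (ln r - ln (v z)).
Proof.
move=> v0 vr; rewrite /Rintegral.
pose g z (t : R) := (((w z)%:R)%:E * ((EFin \o @GRing.inv R) \_ `[v z, r]) t)%E.
have m0 z : measurable_fun (`[0, r]%classic : set R) ((EFin \o @GRing.inv R) \_ `[v z, r]).
  apply/measurable_restrict => //.
  apply: (measurable_funS (E := `[v z, r])) => //; last exact: measurable_inv_itv.
have g0 z t : (0 <= ((EFin \o @GRing.inv R) \_ `[v z, r]) t)%E.
  rewrite patchE; case: ifPn => //; rewrite inE /= in_itv /= => /andP[vt _].
  by rewrite lee_fin invr_ge0 (le_trans _ vt) // ltW.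
transitivity (fine (\int[leb]_(t in `[0%R, r]) (\sum_(z <- S) g z t))%E).
  congr fine; apply: eq_integral => t; rewrite inE /= in_itv /= => /andP[t0 tr].
  rewrite mulr_suml big_mkcond -sumEFin; apply: eq_bigr => z _; rewrite /g patchE.
  have -> : (t \in `[v z, r]%classic) = (v z <= t).
    by apply/idP/idP; rewrite inE /= in_itv /= tr andbT.
  by case: ifP; rewrite ?mule0 // EFinM.
rewrite ge0_integral_sum //; first last.
- by move=> z t _; apply: mule_ge0; [rewrite lee_fin ler0n | exact: g0].
- by move=> z; apply: measurable_funeM; exact: m0.
rewrite (eq_big_seq (fun z => ((w z)%:R * (ln r - ln (v z)))%:E)) ?sumEFin // => z zS.
rewrite ge0_integralZl_EFin //; last exact: m0.
rewrite -integral_mkcondr (_ : _ `&` _ = `[v z, r]%classic).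
  by rewrite integral_inv // ?vr // EFinM.
apply/seteqP; split=> t /=; first by case.
by rewrite !in_itv /= => /andP[vt ->]; rewrite vt (le_trans (ltW (v0 z)) vt).
Qed.

End Counting.

(** * Poles as zeros of the denominator *)

Section PoleCounting.
Variables (R : realType) (K : closedFieldType) (abs : K -> R).
Hypotheses (Habs : nonarch_abs abs) (Hcompl : complete_abs abs).
Implicit Types (f : mero K) (z : K) (S : seq K).

Lemma leq_sum_support (T : eqType) (s S : seq T) (F : T -> nat) : uniq s -> uniq S ->
  (forall z : T, z \in s -> z \notin S -> F z = 0%N) ->
  (\sum_(z <- s) F z <= \sum_(z <- S) F z)%N.
Proof.
move=> us uS H; rewrite (bigID (fun z : T => z \in S)) /= [X in (_ + X)%N]big_seq_cond [X in (_ + X)%N]big1 ?addn0; last first.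
  by move=> z /andP[zs]; exact: H.
rewrite -big_filter (perm_big [seq z : T <- S | z \in s]); last first.
  by apply: uniq_perm; rewrite ?filter_uniq // => z; rewrite !mem_filter andbC.
by rewrite big_filter [leqRHS](bigID (fun z : T => z \in s)) /= leq_addr.
Qed.

(** Poles in the disc are zeros of the denominator, hence lie in [S]; the supremum over finite lists
    is attained at the points of [S] within [t]. *)
Lemma n_poles_eq r f S t : tame abs f.2 -> f.2 != 0 :> psr K ->
  covers_zeros abs r f.2 S -> t <= r ->
  n_poles abs t f = \sum_(z <- S | abs z <= t) (pole_mult abs f z)%:R.
Proof.
move=> t2 f20 [uS Sr cS] tr.
have pm0 z : abs z <= r -> z \notin S -> pole_mult abs f z = 0%N.
  move=> zr zS; have [m om] := order_at_exists Habs z t2 f20.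
  case: m om => [|m] om; first by rewrite /pole_mult (order_at_zord Habs Hcompl om).
  case/negP: zS; apply: cS => //; case: om => b [tb -> _]; rewrite exprS -mulrA.
  exists (XsubC z ^+ m * b) => //; apply: (tame_mul Habs) => //.
  exact/(tame_exp Habs)/(tame_XsubC Habs).
rewrite -natr_sum -big_filter; apply/eqP; rewrite eq_le; apply/andP; split.
  apply: ge_sup; first by exists 0, [::]; split=> //; rewrite big_nil.
  move=> _ [s [us st ->]]; rewrite ler_nat; apply: leq_sum_support => //.
    exact: filter_uniq.
  move=> z zs; rewrite mem_filter (allP st) //=; apply: pm0.
  by apply: le_trans tr; exact: (allP st).
apply: ub_le_sup; last first.
  exists [seq z <- S | abs z <= t]; split=> //; first exact: filter_uniq.
  by apply/allP => z; rewrite mem_filter => /andP[].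
exists (\sum_(z <- S) pole_mult abs f z)%:R => _ [s [us st ->]].
rewrite ler_nat; apply: leq_sum_support => // z zs; apply: pm0.
by apply: le_trans tr; exact: (allP st).
Qed.

(** Only an inequality: a pole with [0 < abs z < 1] is counted with [ln r - ln (abs z)], which
    exceeds its [log_ratio]. *)
Lemma N_count_ge r f S : 1 <= r -> tame abs f.2 -> f.2 != 0 :> psr K ->
  covers_zeros abs r f.2 S ->
  \sum_(z <- S) (pole_mult abs f z)%:R * log_ratio abs r z <= N_count abs r f.
Proof.
move=> r1 t2 f20 cov; have [uS Sr cS] := cov; have r0 : 0 < r by exact: lt_le_trans r1.
(* [Rintegral_jumps] needs positive thresholds. The value at the origin is a dummy: [S0] omits that
   point, whose pole enters through the [ln r] term. *)
pose v z := if z == 0 then 1 else abs z.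
have v0 z : 0 < v z by rewrite /v; case: ifP => // z0; rewrite (abs_gt0 Habs) z0.
pose S0 := [seq z <- S | z != 0].
have vr z : z \in S0 -> v z <= r.
  by rewrite mem_filter => /andP[/negPf z0 /(allP Sr)]; rewrite /v z0.
have absle0 z : (abs z <= 0) = (z == 0).
  by rewrite -(abs_eq0 Habs) eq_le (abs_ge0 Habs) andbT.
rewrite /N_count (n_poles_eq t2 f20 cov (ltW r0)).
rewrite (_ : Rintegral _ _ _ = \sum_(z <- S0) (pole_mult abs f z)%:R * (ln r - ln (v z))); last first.
  rewrite -Rintegral_jumps //; apply: eq_Rintegral => t.
  rewrite inE /= in_itv /= => /andP[t0 tr]; congr (_ / _).
  rewrite (n_poles_eq t2 f20 cov tr) (bigID (fun z => z == 0)) /=.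
  rewrite [X in X + _ - _](_ : _ = \sum_(z <- S | abs z <= 0) (pole_mult abs f z)%:R).
    rewrite addrAC subrr add0r big_filter_cond; apply: eq_bigl => z.
    by rewrite /v andbC; case: eqVneq.
  apply: eq_bigl => z; rewrite absle0; case: eqVneq => [->|_]; last by rewrite andbF.
  by rewrite (abs0 Habs) t0.
rewrite big_filter (bigID (fun z => z == 0)) /= addrC; apply: lerD.
  apply: ler_sum => z z0; apply: ler_wpM2l => //; rewrite /log_ratio /v (negPf z0) lerD2l lerN2.
  by rewrite ler_ln ?posrE ?(abs_gt0 Habs) ?lt_max ?ltr01 // le_max lexx orbT.
rewrite mulr_suml [leRHS](eq_bigl (fun z => z == 0)) => [|z]; last exact: absle0.
apply: ler_sum => z /eqP ->; rewrite /log_ratio (abs0 Habs) max_l // ln1 subr0 //.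
Qed.

Lemma log_ratio_ge0 r z : 1 <= r -> abs z <= r -> 0 <= log_ratio abs r z.
Proof.
move=> r1 zr; have r0 : 0 < r by exact: lt_le_trans r1.
rewrite /log_ratio subr_ge0 ler_ln ?posrE ?lt_max ?ltr01 //.
by rewrite ge_max r1.
Qed.

Lemma N_count_ge0 r f : 1 <= r -> tame abs f.2 -> f.2 != 0 :> psr K -> 0 <= N_count abs r f.
Proof.
move=> r1 t2 f20; have r0 : 0 < r by exact: lt_le_trans r1.
have [S cov] := covers_zeros_exists Habs Hcompl r0 t2 f20.
apply: le_trans (N_count_ge r1 t2 f20 cov); case: cov => _ Sr _.
rewrite big_seq; apply: sumr_ge0 => z zS; apply: mulr_ge0 => //.
by apply: log_ratio_ge0 => //; exact: (allP Sr).
Qed.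

End PoleCounting.

(** * The maximum modulus of a differential polynomial *)

Section MeroNorm.
Variables (R : realType) (K : closedFieldType) (abs : K -> R).
Hypotheses (Habs : nonarch_abs abs) (Hcompl : complete_abs abs).
Implicit Types (r e : R) (f g X Y : mero K) (a b : psr K).

Definition tame_mero f : Prop := [/\ tame abs f.1, tame abs f.2 & f.2 != 0 :> psr K].

Lemma is_meroP : nontrivial_abs abs -> forall f, is_mero abs f -> tame_mero f.
Proof.
move=> nt f [/(entireP Habs Hcompl nt) ? /(entireP Habs Hcompl nt) ? ex]; split=> //.
by apply/ps_neq0P.
Qed.

Lemma tame_mero_mul f g : tame_mero f -> tame_mero g -> tame_mero (mero_mul f g).
Proof.
move=> [? ? ?] [? ? ?]; split; [exact: (tame_mul Habs)..|exact: (ps_mul_neq0 Habs)].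
Qed.

Lemma tame_mero_add f g : tame_mero f -> tame_mero g -> tame_mero (mero_add f g).
Proof.
move=> [? ? ?] [? ? ?]; split; [|exact: (tame_mul Habs)|exact: (ps_mul_neq0 Habs)].
by apply: (tame_add Habs); exact: (tame_mul Habs).
Qed.

Lemma tame_mero_opp f : tame_mero f -> tame_mero (mero_opp f).
Proof. by move=> [? ? ?]; split=> //; exact: (tame_opp Habs). Qed.

Lemma tame_mero_sub f g : tame_mero f -> tame_mero g -> tame_mero (mero_sub f g).
Proof. by move=> tf tg; apply: tame_mero_add => //; exact: tame_mero_opp. Qed.

Lemma tame_mero_der f : tame_mero f -> tame_mero (mero_der f).
Proof.
move=> [t1 t2 n2]; split; [|exact: (tame_mul Habs)|exact: (ps_mul_neq0 Habs)].
apply: (tame_add Habs); last apply: (tame_opp Habs).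
  by apply: (tame_mul Habs) => //; exact: (tame_der Habs).
by apply: (tame_mul Habs) => //; exact: (tame_der Habs).
Qed.

Lemma tame_mero_const x : tame_mero (mero_const x).
Proof.
split; [exact: (tame_const Habs)..|exact: oner_neq0].
Qed.

Lemma mero_eqE f g : mero_eq f g <->
  (f.1 : psr K) * (g.2 : psr K) = (g.1 : psr K) * (f.2 : psr K).
Proof. by []. Qed.

Section AtRadius.
Variable r : R.
Hypothesis r0 : 0 < r.
Local Notation mu := (mu_mero abs r).

Lemma mu_mero_ge0 f : tame_mero f -> 0 <= mu f.
Proof. by move=> [? ? ?]; rewrite divr_ge0 ?(mu_ps_ge0 Habs). Qed.

Lemma mu_meroM f g : tame_mero f -> tame_mero g -> mu (mero_mul f g) = mu f * mu g.
Proof.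
move=> [? ? ?] [? ? ?]; rewrite /mu_mero /=.
rewrite (_ : mu_ps abs r (ps_mul f.1 g.1) = mu_ps abs r f.1 * mu_ps abs r g.1); last first.
  exact: (mu_psM Habs).
rewrite (_ : mu_ps abs r (ps_mul f.2 g.2) = mu_ps abs r f.2 * mu_ps abs r g.2); last first.
  exact: (mu_psM Habs).
by rewrite invfM mulrACA.
Qed.

Lemma mu_mero_add f g e : tame_mero f -> tame_mero g -> mu f <= e -> mu g <= e ->
  mu (mero_add f g) <= e.
Proof.
move=> [t1 t2 n2] [s1 s2 m2]; rewrite /mu_mero /=.
have p2 := mu_ps_gt0 Habs r0 t2 n2; have q2 := mu_ps_gt0 Habs r0 s2 m2.
rewrite (_ : mu_ps abs r (ps_mul f.2 g.2) = mu_ps abs r f.2 * mu_ps abs r g.2); last first.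
  exact: (mu_psM Habs).
rewrite !ler_pdivrMr ?mulr_gt0 // => fe ge.
apply: (mu_ps_add Habs) => //; [exact: (tame_mul Habs)..| |].
  rewrite (_ : mu_ps abs r (ps_mul f.1 g.2) = mu_ps abs r f.1 * mu_ps abs r g.2).
    by rewrite mulrA ler_pM2r.
  exact: (mu_psM Habs).
rewrite (_ : mu_ps abs r (ps_mul g.1 f.2) = mu_ps abs r g.1 * mu_ps abs r f.2).
  by rewrite mulrCA mulrC ler_pM2l // mulrC.
exact: (mu_psM Habs).
Qed.

Lemma mu_mero_opp f : mu (mero_opp f) = mu f.
Proof.
rewrite /mu_mero /= (_ : mu_ps abs r (ps_opp f.1) = mu_ps abs r f.1) //.
exact: (mu_ps_opp Habs).
Qed.

Lemma mu_mero_sub f g e : tame_mero f -> tame_mero g -> mu f <= e -> mu g <= e ->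
  mu (mero_sub f g) <= e.
Proof.
move=> tf tg fe ge; apply: mu_mero_add => //; first exact: tame_mero_opp.
by rewrite mu_mero_opp.
Qed.

Lemma mu_mero_eq f g : tame_mero f -> tame_mero g -> mero_eq f g -> mu f = mu g.
Proof.
move=> [t1 t2 n2] [s1 s2 m2] /mero_eqE /(congr1 (mu_ps abs r)).
rewrite !(mu_psM Habs) // /mu_mero => E.
by apply/eqP; rewrite eqr_div ?lt0r_neq0 ?(mu_ps_gt0 Habs) // E.
Qed.

Lemma mu_mero_const x : mu (mero_const x) = abs x.
Proof. by rewrite /mu_mero /= !(mu_ps_const Habs) // (abs1 Habs) divr1. Qed.

Lemma mu_mero_der f : tame_mero f -> mu (mero_der f) <= mu f / r.
Proof.
move=> [t1 t2 n2]; rewrite /mu_mero /=.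
have p2 := mu_ps_gt0 Habs r0 t2 n2.
rewrite (_ : mu_ps abs r (ps_mul f.2 f.2) = mu_ps abs r f.2 * mu_ps abs r f.2); last first.
  exact: (mu_psM Habs).
rewrite ler_pdivrMr ?mulr_gt0 //.
have -> : mu_ps abs r f.1 / mu_ps abs r f.2 / r * (mu_ps abs r f.2 * mu_ps abs r f.2) =
    mu_ps abs r f.1 * mu_ps abs r f.2 / r by field; rewrite !lt0r_neq0.
have td1 := tame_der Habs t1; have td2 := tame_der Habs t2.
apply: (mu_ps_add Habs) => //; [exact: (tame_mul Habs)|apply: (tame_opp Habs); exact: (tame_mul Habs)| |].
  rewrite (_ : mu_ps abs r (ps_mul (ps_der f.1) f.2) = mu_ps abs r (ps_der f.1) * mu_ps abs r f.2).
    by rewrite mulrAC ler_pM2r // (mu_ps_der Habs).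
  exact: (mu_psM Habs).
rewrite (_ : mu_ps abs r (ps_opp _) = mu_ps abs r f.1 * mu_ps abs r (ps_der f.2)).
  by rewrite -mulrA ler_wpM2l ?(mu_ps_ge0 Habs) // (mu_ps_der Habs).
rewrite -(mu_psM Habs) //; exact: (mu_ps_opp Habs).
Qed.

(* [X] and [Y] are bounded by [B] and differ by at most [B d]: this relation is
   multiplicative in [B], hence propagates through differential monomials. *)
Definition close B d X Y : Prop :=
  [/\ tame_mero X, tame_mero Y, mu X <= B, mu Y <= B & mu (mero_sub X Y) <= B * d].

Lemma close_weaken B B' d X Y : 0 <= d -> B <= B' -> close B d X Y -> close B' d X Y.
Proof.
move=> d0 BB' [tX tY XB YB XYB]; split=> //; [exact: le_trans BB'..|].
by apply: le_trans XYB _; rewrite ler_wpM2r.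
Qed.

Lemma close_refl d X : 0 <= d -> tame_mero X -> close (mu X) d X X.
Proof.
move=> d0 tX; split=> //; rewrite (mu_mero_eq (g := mero_const 0)).
- by rewrite mu_mero_const (abs0 Habs) mulr_ge0 // mu_mero_ge0.
- exact: tame_mero_sub.
- exact: tame_mero_const.
case: X tX => P Q _; apply/mero_eqE => /=.
suff -> : ps_add (ps_mul P Q) (ps_mul (ps_opp P) Q) = 0 :> psr K.
  by rewrite mul0r ps_const0 mul0r.
change ((P : psr K) * (Q : psr K) + (- (P : psr K)) * (Q : psr K) = 0 :> psr K); ring.
Qed.

(** Operations on [mero] unfold to raw functions on sequences; these must be shown as the operations
    of [psr] before [ring] applies. *)
Ltac mero_ring :=
  apply/mero_eqE; rewrite /mero_sub /mero_mul /mero_add /mero_opp /mero_der /=;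
  change (@ps_mul K) with (@GRing.mul (psr K)); change (@ps_add K) with (@GRing.add (psr K));
  change (@ps_opp K) with (@GRing.opp (psr K)); rewrite ?(ps_derM, ps_derD, ps_derN); ring.

Lemma mero_sub_mulE X1 X2 Y1 Y2 :
  mero_eq (mero_sub (mero_mul X1 X2) (mero_mul Y1 Y2))
    (mero_add (mero_mul (mero_sub X1 Y1) X2) (mero_mul Y1 (mero_sub X2 Y2))).
Proof. case: X1 X2 Y1 Y2 => [P1 Q1] [P2 Q2] [S1 T1] [S2 T2]; mero_ring. Qed.

Lemma mero_sub_addE X1 X2 Y1 Y2 :
  mero_eq (mero_sub (mero_add X1 X2) (mero_add Y1 Y2))
    (mero_add (mero_sub X1 Y1) (mero_sub X2 Y2)).
Proof. case: X1 X2 Y1 Y2 => [P1 Q1] [P2 Q2] [S1 T1] [S2 T2]; mero_ring. Qed.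

Lemma mero_sub_derE X Y :
  mero_eq (mero_sub (mero_der X) (mero_der Y)) (mero_der (mero_sub X Y)).
Proof. case: X Y => [P1 Q1] [S1 T1]; mero_ring. Qed.

Lemma mero_sub_subE X Y : mero_eq Y (mero_sub X (mero_sub X Y)).
Proof. case: X Y => [P1 Q1] [S1 T1]; mero_ring. Qed.

Lemma mero_subK X Y : mero_eq X (mero_add (mero_sub X Y) Y).
Proof. case: X Y => [P1 Q1] [S1 T1]; mero_ring. Qed.

(** [mero_sub_mulE] splits the difference into two terms, each at most [B1 * B2 * d]; their sum
    obeys the same bound, being ultrametric. *)
Lemma close_mul B1 B2 d X1 X2 Y1 Y2 : 0 <= d -> 0 <= B1 -> 0 <= B2 ->
  close B1 d X1 Y1 -> close B2 d X2 Y2 -> close (B1 * B2) d (mero_mul X1 X2) (mero_mul Y1 Y2).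
Proof.
move=> d0 B10 B20 [tX1 tY1 X1B Y1B D1] [tX2 tY2 X2B Y2B D2].
have ts1 := tame_mero_sub tX1 tY1; have ts2 := tame_mero_sub tX2 tY2.
split; [exact: tame_mero_mul..| | |].
- by rewrite mu_meroM // ler_pM ?mu_mero_ge0.
- by rewrite mu_meroM // ler_pM ?mu_mero_ge0.
rewrite (mu_mero_eq _ _ (mero_sub_mulE X1 X2 Y1 Y2)); last first.
- by apply: tame_mero_add; exact: tame_mero_mul.
- by apply: tame_mero_sub; exact: tame_mero_mul.
apply: mu_mero_add; [exact: tame_mero_mul..| |]; rewrite mu_meroM //.
  by rewrite [leRHS]mulrAC ler_pM ?mu_mero_ge0.
by rewrite -[leRHS]mulrA ler_pM ?mu_mero_ge0.
Qed.

Lemma close_add B d X1 X2 Y1 Y2 :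
  close B d X1 Y1 -> close B d X2 Y2 -> close B d (mero_add X1 X2) (mero_add Y1 Y2).
Proof.
move=> [tX1 tY1 X1B Y1B D1] [tX2 tY2 X2B Y2B D2].
have ts1 := tame_mero_sub tX1 tY1; have ts2 := tame_mero_sub tX2 tY2.
split; [exact: tame_mero_add..|exact: mu_mero_add|exact: mu_mero_add|].
rewrite (mu_mero_eq _ _ (mero_sub_addE X1 X2 Y1 Y2)); first exact: mu_mero_add.
- by apply: tame_mero_sub; exact: tame_mero_add.
- exact: tame_mero_add.
Qed.

Lemma mu_mero_der_le e X : 1 <= r -> tame_mero X -> mu X <= e -> mu (mero_der X) <= e.
Proof.
move=> r1 tX Xe; apply: le_trans (mu_mero_der tX) _; apply: le_trans Xe.
by rewrite ler_pdivrMr // ler_peMr // mu_mero_ge0.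
Qed.

Lemma close_der B d X Y : 1 <= r -> close B d X Y -> close B d (mero_der X) (mero_der Y).
Proof.
move=> r1 [tX tY XB YB D]; have ts := tame_mero_sub tX tY.
split; [exact: tame_mero_der..|exact: mu_mero_der_le|exact: mu_mero_der_le|].
rewrite (mu_mero_eq _ _ (mero_sub_derE X Y)); first exact: mu_mero_der_le.
- by apply: tame_mero_sub; exact: tame_mero_der.
- exact: tame_mero_der.
Qed.

Lemma close_1 d : 0 <= d -> close 1 d (mero1 K) (mero1 K).
Proof.
by move=> d0; rewrite -[1](abs1 Habs) -mu_mero_const; apply: close_refl => //; exact: tame_mero_const.
Qed.

Lemma close_exp B d X Y k : 0 <= d -> 0 <= B ->
  close B d X Y -> close (B ^+ k) d (mero_exp X k) (mero_exp Y k).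
Proof.
move=> d0 B0 XY; elim: k => [|k IH]; first exact: close_1.
by rewrite exprS; apply: close_mul => //; exact: exprn_ge0.
Qed.

Lemma close_monomial n (ks : seq 'I_n.+1) (i : {ffun 'I_n.+1 -> nat}) B d X Y :
  1 <= r -> 0 <= d -> 0 <= B -> close B d X Y ->
  close (B ^+ (\sum_(k <- ks) i k)) d
    (foldr (fun k p => mero_mul (mero_exp (iter (nat_of_ord k) (@mero_der K) X) (i k)) p) (mero1 K) ks)
    (foldr (fun k p => mero_mul (mero_exp (iter (nat_of_ord k) (@mero_der K) Y) (i k)) p) (mero1 K) ks).
Proof.
move=> r1 d0 B0 XY; elim: ks => [|k ks IH] /=; first by rewrite big_nil; exact: close_1.
rewrite big_cons exprD; apply: close_mul => //; [exact: exprn_ge0..|].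
apply: close_exp => //; elim: (nat_of_ord k) => [//|l IHl] /=; exact: close_der.
Qed.

(** A maximum of the term bounds would do for the sum over [I]. The product also dominates, every
    factor being at least 1, and its logarithm is a sum of proximity functions. *)
Lemma close_diff_poly n (I : seq {ffun 'I_n.+1 -> nat}) (c : {ffun 'I_n.+1 -> nat} -> mero K) B d X Y :
  1 <= r -> 0 <= d -> 1 <= B -> (forall i, i \in I -> tame_mero (c i)) -> close B d X Y ->
  close (\prod_(i <- I) (Num.max 1 (mu (c i)) * B ^+ (\sum_(k <- enum 'I_n.+1) i k))) d
    (mero_diff_poly_eval I c X) (mero_diff_poly_eval I c Y).
Proof.
move=> r1 d0 B1 tc XY; have B0 : 0 <= B by apply: le_trans B1.
elim: I tc => [|i I IH] tc /=.
  rewrite big_nil /mero_diff_poly_eval /=; apply: (@close_weaken 0) => //.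
  rewrite -[0](abs0 Habs) -(mu_mero_const 0); apply: close_refl => //; exact: tame_mero_const.
have {}IH := IH (fun j jI => tc j (mem_behead (s := i :: I) jI)).
have ti : tame_mero (c i) by apply: tc; rewrite mem_head.
have F1 j : 1 <= Num.max 1 (mu (c j)) * B ^+ (\sum_(k <- enum 'I_n.+1) j k).
  by rewrite mulr_ege1 // ?exprn_ege1 // le_max lexx.
have P1 : 1 <= \prod_(i <- I) (Num.max 1 (mu (c i)) * B ^+ (\sum_(k <- enum 'I_n.+1) i k)).
  by apply: (big_ind (fun x => 1 <= x)) => // x y; exact: mulr_ege1.
rewrite big_cons; apply: close_add; last first.
  by apply: close_weaken IH => //; rewrite ler_peMl // (le_trans ler01).
apply: (@close_weaken (mu (c i) * B ^+ (\sum_(k <- enum 'I_n.+1) i k))) => //.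
  rewrite -[leLHS]mulr1; apply: ler_pM => //; first by rewrite mulr_ge0 ?exprn_ge0 ?mu_mero_ge0.
  by rewrite ler_wpM2r ?exprn_ge0 // le_max lexx orbT.
apply: close_mul => //; [exact: mu_mero_ge0|exact: exprn_ge0|exact: close_refl|].
exact: close_monomial.
Qed.

Lemma mu_mero_close_zero B d X Y : 0 <= B -> 0 <= d -> close B d X Y ->
  mero_eq X (mero0 K) -> mu Y <= B * d.
Proof.
move=> B0 d0 [tX tY _ _ D] X0; have ts := tame_mero_sub tX tY.
rewrite (mu_mero_eq tY _ (mero_sub_subE X Y)); last exact: tame_mero_sub.
apply: mu_mero_sub => //.
rewrite (mu_mero_eq tX (tame_mero_const 0) X0) mu_mero_const (abs0 Habs).
exact: mulr_ge0.
Qed.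

End AtRadius.
End MeroNorm.

(** * Poles of a differential polynomial *)

Section PoleOrder.
Variables (R : realType) (K : closedFieldType) (abs : K -> R).
Hypotheses (Habs : nonarch_abs abs) (Hcompl : complete_abs abs).
Implicit Types (f g X Y : mero K) (z : K) (a b P Q : psr K).

(* The pole of [f] at [z] has order at most [m]; unlike [pole_mult], this does
   not degenerate when the numerator vanishes identically. *)
Definition pole_le z m f : Prop := exists j (P Q : psr K),
  [/\ tame abs P, tame abs Q, f.1 = XsubC z ^+ (j - m) * P, f.2 = XsubC z ^+ j * Q &
      ~ vanishes abs z Q].

Lemma tame_XsubC_exp z k : tame abs (XsubC z ^+ k : psr K).
Proof. exact/(tame_exp Habs)/(tame_XsubC Habs). Qed.

Lemma pole_le_exponent z m f j k P Q : tame abs P -> tame abs Q ->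
  f.1 = XsubC z ^+ k * P -> f.2 = XsubC z ^+ j * Q -> ~ vanishes abs z Q ->
  (j - m <= k)%N -> pole_le z m f.
Proof.
move=> tP tQ E1 E2 nQ jk; exists j, (XsubC z ^+ (k - (j - m)) * P), Q; split=> //.
  by apply: (tame_mul Habs) => //; exact: tame_XsubC_exp.
by rewrite E1 mulrA -exprD subnKC.
Qed.

Lemma pole_le_pole_mult z f : tame_mero abs f -> pole_le z (pole_mult abs f z) f.
Proof.
move=> [t1 t2 n2]; have [j oj] := order_at_exists Habs z t2 n2.
rewrite /pole_mult (order_at_zord Habs Hcompl oj); have [Q [tQ E2 nQ]] := oj.
(* A zero numerator is divisible by every power of [X - z], whatever default value [zord] takes on
   it. *)
have [z1|n1] := eqVneq (f.1 : psr K) 0.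
  by exists j, 0, Q; split=> //; [exact: (tame_0 Habs) | rewrite mulr0].
have [i oi] := order_at_exists Habs z t1 n1.
rewrite (order_at_zord Habs Hcompl oi); have [P [tP E1 nP]] := oi.
apply: (pole_le_exponent (j := j) (k := i) (P := P) (Q := Q)) => //; lia.
Qed.

Lemma order_at_XsubC_exp z k : order_at abs z (XsubC z ^+ k) k.
Proof.
exists 1; rewrite mulr1; split=> //; first exact: (tame_1 Habs).
by apply: (not_vanishes_const Habs); rewrite oner_eq0.
Qed.

Lemma zord_pole_le z m f : tame abs f.1 -> f.1 != 0 :> psr K -> pole_le z m f ->
  (zord abs f.2 z <= zord abs f.1 z + m)%N.
Proof.
move=> t1 n1 [j [P [Q [tP tQ E1 E2 nQ]]]].
rewrite (order_at_zord Habs Hcompl (_ : order_at abs z f.2 j)); last by exists Q.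
have P0 : P != 0 by apply: contraNneq n1 => P0; rewrite E1 P0 mulr0.
have [l ol] := order_at_exists Habs z tP P0.
have := order_at_mul Habs Hcompl (order_at_XsubC_exp z (j - m)) ol.
rewrite -E1 => /(order_at_zord Habs Hcompl) ->; lia.
Qed.

Lemma pole_le_mul z m n f g : pole_le z m f -> pole_le z n g -> pole_le z (m + n) (mero_mul f g).
Proof.
move=> [j [P [Q [tP tQ E1 E2 nQ]]]] [k [S [T [tS tT F1 F2 nT]]]].
apply: (pole_le_exponent (j := j + k) (k := (j - m) + (k - n)) (P := P * S) (Q := Q * T)).
- exact: (tame_mul Habs).
- exact: (tame_mul Habs).
- change ((f.1 : psr K) * (g.1 : psr K) = XsubC z ^+ (j - m + (k - n)) * (P * S) :> psr K).
  by rewrite E1 F1 exprD; ring.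
- change ((f.2 : psr K) * (g.2 : psr K) = XsubC z ^+ (j + k) * (Q * T) :> psr K).
  by rewrite E2 F2 exprD; ring.
- by move=> /(vanishes_mul Habs Hcompl tQ tT) [].
- lia.
Qed.

Lemma pole_le_add z m n f g : pole_le z m f -> pole_le z n g -> pole_le z (m + n) (mero_add f g).
Proof.
move=> [j [P [Q [tP tQ E1 E2 nQ]]]] [k [S [T [tS tT F1 F2 nT]]]].
(* Both [(j - m) + k] and [(k - n) + j] are at least [e], so this power divides both terms of the
   numerator. *)
pose e := (j + k - (m + n))%N.
apply: (pole_le_exponent (j := j + k) (k := e)
  (P := XsubC z ^+ ((j - m) + k - e) * (P * T) + XsubC z ^+ ((k - n) + j - e) * (S * Q)) (Q := Q * T)).
- by apply: (tame_add Habs); (apply: (tame_mul Habs); [exact: tame_XsubC_exp|exact: (tame_mul Habs)]).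
- exact: (tame_mul Habs).
- change ((f.1 : psr K) * (g.2 : psr K) + (g.1 : psr K) * (f.2 : psr K) =
    XsubC z ^+ e * (XsubC z ^+ (j - m + k - e) * (P * T) + XsubC z ^+ (k - n + j - e) * (S * Q)) :> psr K).
  rewrite mulrDr !(mulrA (XsubC z ^+ e)) -!exprD !subnKC; [|lia|lia].
  by rewrite E1 F1 E2 F2 !exprD; ring.
- change ((f.2 : psr K) * (g.2 : psr K) = XsubC z ^+ (j + k) * (Q * T) :> psr K).
  by rewrite E2 F2 exprD; ring.
- by move=> /(vanishes_mul Habs Hcompl tQ tT) [].
- by [].
Qed.

Lemma ps_der_XsubC_exp z k P : tame abs P -> exists2 S : psr K, tame abs S &
  (ps_der (XsubC z ^+ k * P) : psr K) = XsubC z ^+ k.-1 * S.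
Proof.
move=> tP; elim: k => [|k [S tS E]].
  by exists (ps_der P); [exact: (tame_der Habs) | rewrite !expr0 !mul1r].
rewrite exprS -mulrA ps_derM E ps_der_XsubC mul1r /=; case: k E => [|k] E /=.
  exists (P + XsubC z * S); last by rewrite expr0; ring.
  by apply: (tame_add Habs) => //; apply: (tame_mul Habs) => //; exact: (tame_XsubC Habs).
exists (P + S); first exact: (tame_add Habs).
by rewrite exprS; ring.
Qed.

(* A pole of order m >= 1 becomes one of order m + 1 <= 2 m under derivation. *)
Lemma pole_le_der z m f : pole_le z m f -> pole_le z (2 * m) (mero_der f).
Proof.
move=> [j [P [Q [tP tQ E1 E2 nQ]]]].
have tQQ := tame_mul Habs tQ tQ.
have nQQ : ~ vanishes abs z (Q * Q) by move=> /(vanishes_mul Habs Hcompl tQ tQ) [].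
have D2 : (mero_der f).2 = XsubC z ^+ (j + j) * (Q * Q).
  change ((f.2 : psr K) * (f.2 : psr K) = XsubC z ^+ (j + j) * (Q * Q) :> psr K).
  by rewrite E2 exprD; ring.
(* For [m = 0] the derivative must again be pole-free: with [t = (X - z)^j], [(t P)' (t Q) - (t P)
   (t Q)' = t^2 (P' Q - P Q')]. *)
case: m E1 => [|m] E1.
  have tdP := tame_der Habs tP; have tdQ := tame_der Habs tQ.
  apply: (pole_le_exponent (k := j + j)
    (P := (ps_der P : psr K) * Q - P * (ps_der Q : psr K)) _ tQQ _ D2) => //; last lia.
    by apply: (tame_sub Habs); exact: (tame_mul Habs).
  change ((ps_der f.1 : psr K) * (f.2 : psr K) - (f.1 : psr K) * (ps_der f.2 : psr K) =
    XsubC z ^+ (j + j) * ((ps_der P : psr K) * Q - P * (ps_der Q : psr K)) :> psr K).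
  rewrite E1 E2 subn0 exprD; move: (XsubC z ^+ j) => t; rewrite !ps_derM; ring.
have [S tS ES] := ps_der_XsubC_exp z (j - m.+1) tP; have [T tT ET] := ps_der_XsubC_exp z j tQ.
pose e := (j - m.+1 + j).-1.
(* In the first case no power has to divide the numerator; in the second [j - m.+1] is positive, so
   the predecessors in the exponents are not truncated. *)
have [je|je] := leqP (j + j) (2 * m.+1).
  apply: (pole_le_exponent (k := 0) (P := (ps_der f.1 : psr K) * (f.2 : psr K) -
    (f.1 : psr K) * (ps_der f.2 : psr K)) _ tQQ _ D2) => //; last lia.
    rewrite E1 E2 ES ET; apply: (tame_sub Habs); apply: (tame_mul Habs);
      by apply: (tame_mul Habs) => //; exact: tame_XsubC_exp.
  by rewrite expr0 mul1r.
apply: (pole_le_exponent (k := e) (P := S * Q - P * T) _ tQQ _ D2) => //; last by rewrite /e; lia.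
  by apply: (tame_sub Habs); exact: (tame_mul Habs).
change ((ps_der f.1 : psr K) * (f.2 : psr K) - (f.1 : psr K) * (ps_der f.2 : psr K) =
  XsubC z ^+ e * (S * Q - P * T) :> psr K).
rewrite E1 E2 ES ET.
have -> : XsubC z ^+ e = XsubC z ^+ (j - m.+1).-1 * XsubC z ^+ j :> psr K.
  by rewrite -exprD; congr (_ ^+ _); rewrite /e; lia.
have -> : XsubC z ^+ (j - m.+1) = XsubC z ^+ (j - m.+1).-1 * XsubC z :> psr K.
  by rewrite -exprSr; congr (_ ^+ _); lia.
have -> : XsubC z ^+ j = XsubC z ^+ j.-1 * XsubC z :> psr K.
  by rewrite -exprSr; congr (_ ^+ _); lia.
ring.
Qed.

Lemma pole_le_const z x : pole_le z 0 (mero_const x).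
Proof.
exists 0%N, (ps_const x), (ps_const 1); split; rewrite ?expr0 ?mul1r //.
- exact: (tame_const Habs).
- exact: (tame_const Habs).
- by apply: (not_vanishes_const Habs); rewrite oner_eq0.
Qed.

Lemma pole_le_exp z m f k : pole_le z m f -> pole_le z (k * m) (mero_exp f k).
Proof.
move=> fm; elim: k => [|k IH]; first exact: pole_le_const.
by rewrite mulSn; apply: pole_le_mul.
Qed.

(** The weight [2 ^ k] comes from [k] successive doublings by [pole_le_der]. *)
Lemma pole_le_monomial n (ks : seq 'I_n.+1) (i : {ffun 'I_n.+1 -> nat}) z m X :
  pole_le z m X ->
  pole_le z ((\sum_(k <- ks) i k * 2 ^ k) * m)
    (foldr (fun k p => mero_mul (mero_exp (iter (nat_of_ord k) (@mero_der K) X) (i k)) p) (mero1 K) ks).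
Proof.
move=> Xm; elim: ks => [|k ks IH] /=; first by rewrite big_nil mul0n; exact: pole_le_const.
rewrite big_cons mulnDl; apply: pole_le_mul => //; rewrite -mulnA; apply: pole_le_exp.
elim: (nat_of_ord k) => [|l IHl] /=; first by rewrite expn0 mul1n.
by rewrite expnS -mulnA; apply: pole_le_der.
Qed.

Lemma pole_le_diff_poly n (I : seq {ffun 'I_n.+1 -> nat}) (c : {ffun 'I_n.+1 -> nat} -> mero K)
    (p : {ffun 'I_n.+1 -> nat} -> nat) z m X :
  (forall i, i \in I -> pole_le z (p i) (c i)) -> pole_le z m X ->
  pole_le z (\sum_(i <- I) (p i + (\sum_(k <- enum 'I_n.+1) i k * 2 ^ k) * m))
    (mero_diff_poly_eval I c X).
Proof.
move=> Hc Xm; elim: I Hc => [|i I IH] Hc; first by rewrite big_nil; exact: pole_le_const.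
rewrite big_cons; apply: pole_le_add; last first.
  by apply: IH => j jI; apply: Hc; rewrite inE jI orbT.
apply: pole_le_mul; first by apply: Hc; rewrite mem_head.
exact: pole_le_monomial.
Qed.

(** One list for all functions involved turns Jensen's formula and the counting functions into sums
    over the same points. *)
Lemma common_covers_zeros r (Ps : seq (psr K)) : 0 < r ->
  (forall P, P \in Ps -> tame abs P /\ P != 0) ->
  exists S, forall P, P \in Ps -> covers_zeros abs r P S.
Proof.
move=> r0; elim: Ps => [|P Ps IH] H; first by exists [::].
have [S HS] := IH (fun Q QPs => H Q (mem_behead (s := P :: Ps) QPs)).
have [tP P0] := H P (mem_head _ _).
have [s [us sr cs]] := covers_zeros_exists Habs Hcompl r0 tP P0.
exists (undup (s ++ [seq z <- S | abs z <= r])) => Q; rewrite inE => QP; split.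
- exact: undup_uniq.
- apply/allP => z; rewrite mem_undup mem_cat mem_filter => /orP[/(allP sr)//|/andP[//]].
- move=> z zr vz; rewrite mem_undup mem_cat mem_filter zr /=.
  case/orP: QP => [/eqP QP|/HS [_ _ cS]]; first by rewrite cs // -QP.
  by rewrite (cS z) ?orbT.
Qed.

(* The first main theorem, in the one direction that is needed. *)
Lemma ln_mu_mero_lower (r : R) (h : mero K) (J : eqType) (I : seq J) (c : J -> mero K)
    (D : J -> nat) (a : mero K) :
  1 <= r -> tame_mero abs h -> h.1 != 0 :> psr K ->
  (forall i, i \in I -> tame_mero abs (c i)) -> tame_mero abs a ->
  (forall z, pole_le z (\sum_(i <- I) (pole_mult abs (c i) z + D i * pole_mult abs a z)) h) ->
  ln (mu_mero abs 1 h) - ln (mu_mero abs r h) <=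
  \sum_(i <- I) (N_count abs r (c i) + (D i)%:R * N_count abs r a).
Proof.
move=> r1 [t1 t2 n2] n1 tc [ta1 ta2 na2] Hp; have r0 : 0 < r by exact: lt_le_trans r1.
pose Ps : seq (psr K) := [:: h.1, h.2, a.2 & [seq (c i).2 | i <- I]].
have tPs P : P \in Ps -> tame abs P /\ P != 0.
  by rewrite !inE => /or4P[/eqP ->|/eqP ->|/eqP ->|/mapP[i /tc [? ? ?] ->]].
have [S cov] := common_covers_zeros r0 tPs.
have c1 : covers_zeros abs r h.1 S by apply: cov; rewrite !inE eqxx.
have c2 : covers_zeros abs r h.2 S by apply: cov; rewrite !inE eqxx orbT.
have ca : covers_zeros abs r a.2 S by apply: cov; rewrite !inE eqxx !orbT.
have cc i : i \in I -> covers_zeros abs r (c i).2 S.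
  by move=> iI; apply: cov; rewrite !inE (map_f (fun i => (c i).2 : psr K) iI) !orbT.
have lnmu r' : 0 < r' -> ln (mu_mero abs r' h) = ln (mu_ps abs r' h.1) - ln (mu_ps abs r' h.2).
  by move=> r'0; rewrite ln_div ?posrE ?(mu_ps_gt0 Habs).
have J1 := jensen Habs Hcompl r1 t1 n1 c1; have J2 := jensen Habs Hcompl r1 t2 n2 c2.
rewrite !lnmu //.
have -> : ln (mu_ps abs 1 h.1) - ln (mu_ps abs 1 h.2) -
  (ln (mu_ps abs r h.1) - ln (mu_ps abs r h.2)) =
  (ln (mu_ps abs r h.2) - ln (mu_ps abs 1 h.2)) - (ln (mu_ps abs r h.1) - ln (mu_ps abs 1 h.1)) by ring.
rewrite J1 J2 -sumrB; have [_ Sr _] := c1.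
apply: (@le_trans _ _ (\sum_(i <- I) (\sum_(z <- S) (pole_mult abs (c i) z)%:R * log_ratio abs r z +
   (D i)%:R * \sum_(z <- S) (pole_mult abs a z)%:R * log_ratio abs r z))); last first.
  rewrite big_seq [leRHS]big_seq; apply: ler_sum => i iI.
  have [ti1 ti2 ni2] := tc i iI.
  apply: lerD; first exact: (N_count_ge Habs Hcompl r1 ti2 ni2 (cc i iI)).
  by rewrite ler_wpM2l // (N_count_ge Habs Hcompl r1 ta2 na2 ca).
under [leRHS]eq_bigr do rewrite mulr_sumr -big_split.
(* Summed over points first, the inequality holds term by term: [zord_pole_le] compares the
   multiplicities, and [log_ratio] is nonnegative. *)
rewrite exchange_big /= big_seq [leRHS]big_seq; apply: ler_sum => z zS.
have zr : abs z <= r by exact: (allP Sr).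
rewrite -mulrBl; under eq_bigr do rewrite mulrA -mulrDl.
rewrite -mulr_suml ler_wpM2r ?(log_ratio_ge0 r1 zr) // lerBlDl.
under eq_bigr do rewrite -natrM -natrD.
by rewrite -natr_sum -natrD ler_nat (zord_pole_le t1 n1 (Hp z)).
Qed.

End PoleOrder.

(** * Growth of the characteristic function *)

Ltac ps_ring := lazymatch goal with |- @eq _ ?x ?y => change (x = y :> psr _) end; ring.

Section Growth.
Variables (R : realType) (K : closedFieldType) (abs : K -> R).
Hypotheses (Habs : nonarch_abs abs) (Hcompl : complete_abs abs).
Implicit Types (f g : mero K) (z : K).

Lemma logpE (x : R) : 0 <= x -> logp x = ln (Num.max 1 x).
Proof.
move=> x0; rewrite /logp; have [x1|/ltW x1] := leP 1 x.
  by rewrite max_r // ln_ge0.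
by rewrite ln1 max_l // ln_le0.
Qed.

Lemma logp_ge0 (x : R) : 0 <= logp x.
Proof. by rewrite /logp le_max lexx. Qed.

Lemma T_char_ge0 (r : R) f : 1 <= r -> tame_mero abs f -> 0 <= T_char abs r f.
Proof.
by move=> r1 [_ t2 n2]; rewrite addr_ge0 ?logp_ge0 // (N_count_ge0 Habs Hcompl).
Qed.

(** The pole at [z] enters the counting sum with multiplicity at least 1, and all other terms are
    nonnegative. *)
Lemma T_char_pole (f : mero K) z : tame_mero abs f -> pole_mult abs f z != 0%N ->
  forall r : R, Num.max 1 (abs z) <= r ->
  ln r - ln (Num.max 1 (abs z)) <= T_char abs r f.
Proof.
move=> [t1 t2 n2] pz r; rewrite ge_max => /andP[r1 zr]; have r0 : 0 < r by exact: lt_le_trans r1.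
have [S cov] := covers_zeros_exists Habs Hcompl r0 t2 n2; have [uS Sr cS] := cov.
have zS : z \in S.
  apply: cS => //; have [m om] := order_at_exists Habs z t2 n2.
  case: m om => [|m] om; first by rewrite /pole_mult (order_at_zord Habs Hcompl om) in pz.
  case: om => b [tb E _]; exists (XsubC z ^+ m * b); last by rewrite E exprS -mulrA.
  by apply: (tame_mul Habs) => //; exact: tame_XsubC_exp.
rewrite -[leLHS]add0r lerD ?logp_ge0 //; apply: le_trans (N_count_ge Habs Hcompl r1 t2 n2 cov).
have l0 : 0 <= log_ratio abs r z by exact: log_ratio_ge0.
rewrite (bigD1_seq z) //= -[leLHS]addr0; apply: lerD.
  by rewrite -[leLHS]mul1r ler_wpM2r // ler1n lt0n.
rewrite big_seq_cond; apply: sumr_ge0 => x /andP[xS _]; apply: mulr_ge0 => //.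
by apply: log_ratio_ge0 => //; exact: (allP Sr).
Qed.

(* Without poles, (f - f(0)) / X is still pole-free, so Jensen forces
   mu(r, f - f(0)) to grow at least linearly. *)
Lemma mu_mero_pole_free f : tame_mero abs f -> nonconstant f ->
  (forall z, pole_mult abs f z = 0%N) ->
  exists (c : K) (C : R), 0 < C /\
    forall r : R, 1 <= r -> C * r <= Num.max (mu_mero abs r f) (abs c).
Proof.
move=> tf nf pf; have [t1 t2 n2] := tf.
have Hp z : pole_le abs z 0 f by rewrite -(pf z); exact: (pole_le_pole_mult Habs Hcompl).
have [j [P [Q [tP tQ E1 E2 nQ]]]] := Hp 0; rewrite subn0 in E1.
have Q0 : Q 0%N != 0 by apply/eqP => /(vanishes_at0 Habs Hcompl tQ).
(* The value [f(0)], read after removing the common power of [X]. *)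
pose c := P 0%N / Q 0%N.
have cE (S : psr K) k : ((ps_const c : psr K) * S) k = c * S k.
  rewrite ps_mulE big_ord_recl big1 ?addr0 ?subn0 // => i _; exact: mul0r.
have tc : tame abs (ps_const c) by exact: (tame_const Habs).
have tD : tame abs (P - (ps_const c : psr K) * Q).
  by apply: (tame_sub Habs) => //; exact: (tame_mul Habs).
have [E tE EE] : vanishes abs 0 (P - (ps_const c : psr K) * Q).
  by apply: (vanishes_at0 Habs Hcompl) => //; rewrite ps_addE ps_oppE cE /c divfK // subrr.
pose N : psr K := (f.1 : psr K) - (ps_const c : psr K) * (f.2 : psr K).
have tN : tame abs N by apply: (tame_sub Habs) => //; exact: (tame_mul Habs).
have nN : N != 0.
  apply/eqP => N0; apply: (nf c); apply/mero_eqE => /=.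
  rewrite -[RHS]add0r -N0 /N subrK; exact: mulr1.
(* Represents [(f - c) / X]; by [EE] the new factor [X] of the denominator cancels at 0. *)
pose h : mero K := (N, (XsubC 0 : psr K) * (f.2 : psr K)).
have th : tame_mero abs h.
  split=> //; first by apply: (tame_mul Habs) => //; exact: (tame_XsubC Habs).
  by apply: (ps_mul_neq0 Habs) => //; [exact: (tame_XsubC Habs)|exact: XsubC_neq0].
have hp z : pole_le abs z 0 h.
  have [->|z0] := eqVneq z 0.
    exists j.+1, E, Q; split=> //; rewrite ?subn0 /=.
      by rewrite /N E1 E2 exprSr -[RHS]mulrA -EE; ps_ring.
    by rewrite E2 exprS mulrA.
  have [k [S [T [tS tT F1 F2 nT]]]] := Hp z; rewrite subn0 in F1.
  exists k, (S - (ps_const c : psr K) * T), (XsubC 0 * T); split=> //.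
  - by apply: (tame_sub Habs) => //; exact: (tame_mul Habs).
  - by apply: (tame_mul Habs) => //; exact: (tame_XsubC Habs).
  - by rewrite /= /N F1 F2 subn0; ps_ring.
  - by rewrite /= F2; ps_ring.
  move=> /(vanishes_mul Habs Hcompl (tame_XsubC Habs 0) tT) [] //.
  have [b [_ E0 nb]] := order_at_XsubC Habs z 0; rewrite eq_sym (negbTE z0) /= in E0.
  by rewrite E0 expr0 mul1r.
have m10 : 0 < mu_mero abs 1 h.
  by case: th => h1 h2 h3; rewrite divr_gt0 ?(mu_ps_gt0 Habs).
exists c, (mu_mero abs 1 h); split=> // r r1.
have r0 : 0 < r by exact: lt_le_trans r1.
have mr0 : 0 < mu_mero abs r h.
  by case: th => h1 h2 h3; rewrite divr_gt0 ?(mu_ps_gt0 Habs).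
(* With an empty family of coefficients the bound is 0, and the estimate reads
   [mu(1, h) <= mu(r, h)]. *)
have Hc (i : nat) : i \in [::] -> tame_mero abs (mero0 K) by [].
have Hz z : pole_le abs z (\sum_(i <- [::] : seq nat)
    (pole_mult abs (mero0 K) z + 0 * pole_mult abs (mero0 K) z)) h by rewrite big_nil.
have := ln_mu_mero_lower Habs Hcompl r1 th nN Hc (tame_mero_const Habs 0) Hz.
rewrite big_nil subr_le0 ler_ln ?posrE // => le1.
have p2 : 0 < mu_ps abs r f.2 by exact: (mu_ps_gt0 Habs).
have hE : mu_mero abs r h * r = mu_ps abs r N / mu_ps abs r f.2.
  rewrite /mu_mero /= (mu_psM Habs) //; last exact: (tame_XsubC Habs).
  rewrite (mu_ps_XsubC Habs) // (abs0 Habs) max_l ?ltW //.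
  by field; rewrite !lt0r_neq0.
apply: le_trans (_ : mu_mero abs r h * r <= _); first by rewrite ler_pM2r.
rewrite hE ler_pdivrMr //; apply: (mu_ps_add Habs) => //.
- by apply: (tame_opp Habs); exact: (tame_mul Habs).
- by rewrite -ler_pdivrMr // le_max lexx.
rewrite (mu_ps_opp Habs) (mu_psM Habs) // (mu_ps_const Habs) //.
by rewrite ler_pM2r // le_max lexx orbT.
Qed.

Lemma ln_unbounded (A : R) : exists r0 : R, forall r, r0 < r -> A <= ln r.
Proof.
exists (expR A) => r Ar; rewrite -(expRK A) ler_ln ?posrE ?expR_gt0 //; first exact: ltW.
by apply: lt_trans Ar; exact: expR_gt0.
Qed.

(** A pole forces the counting function to grow like [ln r]; without poles the proximity function
    does so. *)
Lemma T_char_unbounded f : tame_mero abs f -> nonconstant f ->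
  forall A : R, exists r0 : R, forall r, r0 < r -> A <= T_char abs r f.
Proof.
move=> tf nf A; have [t1 t2 n2] := tf.
have [[z pz]|np] := pselect (exists z, pole_mult abs f z != 0%N).
  have [r0 H] := ln_unbounded (A + ln (Num.max 1 (abs z))).
  exists (Num.max r0 (Num.max 1 (abs z))) => r; rewrite gt_max => /andP[/H Ar zr].
  by apply: le_trans (T_char_pole tf pz (ltW zr)); rewrite lerBrDr.
have pf z : pole_mult abs f z = 0%N.
  by apply/eqP; apply: contrapT => /negP pz; apply: np; exists z.
have [c [C [C0 HC]]] := mu_mero_pole_free tf nf pf.
have [r0 H] := ln_unbounded (A - ln C).
(* Beyond [abs c / C] the linear lower bound exceeds [abs c], so it bounds [mu_mero abs r f]
   itself. *)
exists (Num.max r0 (Num.max 1 (abs c / C))) => r.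
rewrite !gt_max => /andP[/H Ar /andP[r1 cr]]; have rp : 0 < r by exact: lt_trans r1.
rewrite ltr_pdivrMr // mulrC in cr.
have : C * r <= mu_mero abs r f.
  by have := HC r (ltW r1); rewrite le_max => /orP[//|]; rewrite leNgt cr.
move=> le1; have Cr0 : 0 < C * r by exact: mulr_gt0.
rewrite -[A]addr0; apply: lerD; last exact: (N_count_ge0 Habs Hcompl (ltW r1)).
rewrite /m_prox /logp le_max; apply/orP; right.
apply: le_trans (_ : ln (C * r) <= _); first by rewrite lnM ?posrE // -lerBlDl.
by rewrite ler_ln ?posrE // (lt_le_trans Cr0).
Qed.

(** * The proximity function of [1 / (f - a)] *)

Lemma ln_prod (J : Type) (I : seq J) (F : J -> R) : (forall i, 0 < F i) ->
  ln (\prod_(i <- I) F i) = \sum_(i <- I) ln (F i).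
Proof.
move=> F0; elim: I => [|i I IH]; first by rewrite !big_nil ln1.
rewrite !big_cons lnM ?posrE ?IH //.
by apply: (big_ind (fun x => 0 < x)) => // x y; exact: mulr_gt0.
Qed.

(** The degree [d i] multiplies [m(r, a)], coming from sizes; the weighted degree [D i] multiplies
    [N(r, a)], coming from poles. Their sum is a common coefficient for [T(r, a)]. *)
Lemma m_prox_inv_sub_le n (I : seq {ffun 'I_n.+1 -> nat}) (c : {ffun 'I_n.+1 -> nat} -> mero K)
    (f a : mero K) (r : R) (d := fun i : {ffun 'I_n.+1 -> nat} => (\sum_(k <- enum 'I_n.+1) i k)%N)
    (D := fun i : {ffun 'I_n.+1 -> nat} => (\sum_(k <- enum 'I_n.+1) i k * 2 ^ k)%N) :
  1 <= r -> (forall i, i \in I -> tame_mero abs (c i)) -> tame_mero abs f -> tame_mero abs a ->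
  mero_eq (mero_diff_poly_eval I c f) (mero0 K) ->
  ~ mero_eq (mero_diff_poly_eval I c a) (mero0 K) ->
  m_prox abs r (mero_inv (mero_sub f a)) <=
    \sum_(i <- I) T_char abs r (c i) + (\sum_(i <- I) (d i + D i))%:R * T_char abs r a
    + `|ln (mu_mero abs 1 (mero_diff_poly_eval I c a))|.
Proof.
move=> r1 tc tf ta f0 na; have r0 : 0 < r by exact: lt_le_trans r1.
set H := mero_diff_poly_eval I c a.
have Ta := T_char_ge0 r1 ta.
have Tc i : i \in I -> 0 <= T_char abs r (c i) by move=> iI; apply: T_char_ge0 => //; exact: tc.
have rhs0 : 0 <= \sum_(i <- I) T_char abs r (c i) + (\sum_(i <- I) (d i + D i))%:R * T_char abs r a
    + `|ln (mu_mero abs 1 H)|.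
  by rewrite !addr_ge0 ?mulr_ge0 // big_seq sumr_ge0.
have tg : tame_mero abs (mero_sub f a) by exact: tame_mero_sub.
set g := mero_sub f a in tg *; pose e := mu_mero abs r g.
have e0 : 0 <= e by exact: (mu_mero_ge0 Habs).
have -> : m_prox abs r (mero_inv g) = logp (e^-1) by rewrite /m_prox /mu_mero /e invf_div.
have [e1|e1] := leP 1 e.
  by rewrite /logp max_l // ln_le0 // invf_le1 // (lt_le_trans ltr01).
(* At [e = 0] the conventions [0^-1 = 0] and [ln 0 = 0] make the proximity function 0. *)
move: e0; rewrite le_eqVlt => /orP[/eqP <-|e0].
  by rewrite invr0 /logp ln0 // maxxx.
pose B := Num.max 1 (mu_mero abs r a).
have B1 : 1 <= B by rewrite le_max lexx.
have B0 : 0 < B by exact: lt_le_trans B1.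
(* The relative error is [e = mu(r, f - a)] itself; since [e < 1 <= B], the bound [B] also holds for
   [f = (f - a) + a]. *)
have cfa : close abs r B e f a.
  split=> //; last 1 first.
  - by rewrite ler_peMl // ltW.
  - rewrite (mu_mero_eq Habs r0 tf _ (mero_subK f a)); last exact: (tame_mero_add Habs).
    apply: (mu_mero_add Habs) => //; last by rewrite le_max lexx orbT.
    by rewrite le_max ltW.
  - by rewrite le_max lexx orbT.
have cH := close_diff_poly Habs r0 r1 (ltW e0) B1 tc cfa.
set M := \prod_(i <- I) _ in cH.
have Fi0 i : 0 < Num.max 1 (mu_mero abs r (c i)) * B ^+ d i.
  by rewrite mulr_gt0 ?exprn_gt0 // lt_max ltr01.
have M0 : 0 < M by apply: (big_ind (fun x => 0 < x)) => // x y; exact: mulr_gt0.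
have := mu_mero_close_zero Habs r0 (ltW M0) (ltW e0) cH f0; rewrite -/H => HM.
have tH : tame_mero abs H by case: cH.
have nH : H.1 != 0 :> psr K.
  apply/eqP => H1; apply: na; apply/mero_eqE; rewrite -/H H1 mul0r.
  by rewrite (_ : (mero0 K).1 = 0 :> psr K) ?mul0r.
have mH : 0 < mu_mero abs r H.
  by case: tH => h1 h2 h3; rewrite divr_gt0 ?(mu_ps_gt0 Habs).
have lnME : ln M = \sum_(i <- I) (m_prox abs r (c i) + (d i)%:R * m_prox abs r a).
  rewrite /M ln_prod //; apply: eq_big_seq => i iI.
  rewrite lnM ?posrE ?exprn_gt0 // ?lt_max ?ltr01 // lnXn // -[ln B *+ _]mulr_natl /m_prox.
  rewrite !logpE //; first exact: (mu_mero_ge0 Habs).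
  by apply: (mu_mero_ge0 Habs) => //; exact: tc.
have Hp z : pole_le abs z (\sum_(i <- I) (pole_mult abs (c i) z + D i * pole_mult abs a z)) H.
  apply: (pole_le_diff_poly Habs Hcompl) => [i iI|]; apply: (pole_le_pole_mult Habs Hcompl) => //.
  exact: tc.
have Hlow := ln_mu_mero_lower Habs Hcompl r1 tH nH tc ta Hp.
rewrite /logp ge_max rhs0 /= lnV ?posrE //.
have le1 : ln (mu_mero abs r H) <= ln M + ln e.
  by rewrite -lnM ?posrE // ler_ln ?posrE //; exact: mulr_gt0.
(* [le1] gives [- ln e <= ln M - ln mu(r, H)], and [Hlow] trades [- ln mu(r, H)] for counting
   functions and the constant [- ln mu(1, H)]. *)
apply: (@le_trans _ _ (ln M + \sum_(i <- I) (N_count abs r (c i) + (D i)%:R * N_count abs r a)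
  - ln (mu_mero abs 1 H))); first by lra.
rewrite lnME -big_split /=; apply: lerD; last by rewrite -normrN ler_norm.
rewrite natr_sum mulr_suml -big_split /=; apply: ler_sum => i _.
have Na : 0 <= N_count abs r a by case: ta => _ ? ?; exact: (N_count_ge0 Habs Hcompl).
have ma : 0 <= m_prox abs r a by exact: logp_ge0.
have h1 : 0 <= (d i)%:R * N_count abs r a by rewrite mulr_ge0.
have h2 : 0 <= (D i)%:R * m_prox abs r a by rewrite mulr_ge0.
rewrite /T_char natrD; lra.
Qed.

End Growth.

Theorem theorem1p5 (R : realType) (K : closedFieldType) (abs : K -> R)
  (Habs : nonarch_abs abs) (Hnontriv : nontrivial_abs abs)
  (Hcompl : complete_abs abs) (Hchar0 : [pchar K] =i pred0)
  (n : nat) (Hn : (0 < n)%N)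
  (I : seq {ffun 'I_n.+1 -> nat}) (c : {ffun 'I_n.+1 -> nat} -> mero K)
  (HIuniq : uniq I) (Hcmero : forall i, i \in I -> is_mero abs (c i))
  (HOmega_nz : exists2 i, i \in I & ~ mero_eq (c i) (mero0 K))
  (f : mero K) (Hf : is_mero abs f) (Hfnc : nonconstant f)
  (Hfsol : mero_eq (mero_diff_poly_eval I c f) (mero0 K))
  (Hadm : little_o_pinfty (fun r => \sum_(i <- I) T_char abs r (c i))
                          (fun r => T_char abs r f))
  (a : mero K) (Ha : is_mero abs a)
  (Hasmall : little_o_pinfty (fun r => T_char abs r a) (fun r => T_char abs r f))
  (HaOmega : ~ mero_eq (mero_diff_poly_eval I c a) (mero0 K)) :
  little_o_pinfty (fun r => m_prox abs r (mero_inv (mero_sub f a)))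
                  (fun r => T_char abs r f).
Proof.
move=> eps eps0.
have tc i : i \in I -> tame_mero abs (c i).
  by move=> iI; apply: (is_meroP Habs Hcompl Hnontriv); exact: Hcmero.
have tf := is_meroP Habs Hcompl Hnontriv Hf; have ta := is_meroP Habs Hcompl Hnontriv Ha.
pose E : R := (\sum_(i <- I) ((\sum_(k <- enum 'I_n.+1) i k) +
                             (\sum_(k <- enum 'I_n.+1) i k * 2 ^ k)))%N%:R.
pose C := `|ln (mu_mero abs 1 (mero_diff_poly_eval I c a))|.
have E0 : 0 <= E by [].
have E1 : 0 < E + 1 by lra.
(* One third each for the coefficients, the multiple of [T(r, a)] and the additive constant.
   Dividing by [E + 1] keeps the divisor positive and still dominates the factor [E]. *)
have eps3 : 0 < eps / 3 by lra.
have [r1 H1] := Hadm _ eps3; have [r2 H2] := Hasmall _ (divr_gt0 eps3 E1).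
have [r3 H3] := T_char_unbounded Habs Hcompl tf Hfnc (C / (eps / 3)).
exists (Num.max 1 (Num.max r1 (Num.max r2 r3))) => r.
rewrite !gt_max => /andP[/ltW r_1 /andP[/H1 {}H1 /andP[/H2 {}H2 /H3 {}H3]]].
rewrite ger0_norm ?logp_ge0 //.
apply: le_trans (m_prox_inv_sub_le Habs Hcompl r_1 tc tf ta Hfsol HaOmega) _.
rewrite -/C -/E; set T := `|T_char abs r f| in H1 H2 *.
have C3 : C <= eps / 3 * T.
  by rewrite mulrC -ler_pdivrMr //; apply: le_trans H3 _; exact: ler_norm.
have {}H1 := le_trans (ler_norm _) H1.
have {}H2 : E * T_char abs r a <= eps / 3 * T.
  have := le_trans (ler_norm _) H2; rewrite mulrAC ler_pdivlMr // => H.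
  have Ta := T_char_ge0 Habs Hcompl r_1 ta; apply: le_trans H.
  by rewrite mulrC ler_wpM2l // lerDl.
lra.
Qed.
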